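(* If $\mathrm{HMEL}_0 \vdash H \to A$ and $\mathrm{HMEL}_0 \vdash G[e_0/A^\bullet] \to B$, then $\mathrm{HMEL}_0 \vdash G[e_0/H] \to B$ (cut elimination / admissibility of cut).
   Context: Hypergraphs $\langle V,E,att,lab,ext\rangle$ are labeled by types; $G[e/H]$ is hyperedge replacement; $A^\bullet$ is the handle (one hyperedge labeled $A$ whose attachment nodes are exactly the external nodes in order); $H_1+H_2$ is disjoint union (defined when one summand is zero rank) and $k\cdot H$ is $k$-fold disjoint union. The hypergraph Lambek calculus $\mathrm{HL}$ has types built from primitive ranked types by $N\div D$ (where $D$ is a hypergraph labeled by types except one hyperedge $e^\$_D$ labeled $\$_d$, $rk(N)=rk(D)$, $rk(N\div D)=d$) and $\times(M)$ ($M$ labeled by types, $rk(\times(M))=rk(M)$); sequents $H\to A$ with $rk(H)=rk(A)$; axiom $A^\bullet\to A$; rules: $(\div\to)$ from $H[e/N^\bullet]\to A$ and $H_i\to lab_D(d_i)$ ($E_D=\{e^\$_D,d_1,\dots,d_k\}$) infer $H[e/D[e^\$_D/(N\div D)^\bullet,d_1/H_1,\dots,d_k/H_k]]\to A$; $(\to\div)$ from $D[e^\$_D/F]\to N$ infer $F\to N\div D$; $(\to\times)$ from $H_i\to lab_M(m_i)$ ($E_M=\{m_1,\dots,m_l\}$) infer $M[m_1/H_1,\dots,m_l/H_l]\to\times(M)$; $(\times\to)$ from $H[e/M]\to A$ infer $H[e/(\times(M))^\bullet]\to A$. The hypergraph multiplicative-exponential Lambek calculus $\mathrm{HMEL}_0$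 extends $\mathrm{HL}$: if $A$ is a type with $rk(A)=0$, then $!A$ is a type of rank $0$ (the exponential is allowed only on rank-0 types), with additional rules $(!\to)$: from $H+A^\bullet\to B$ infer $H+(!A)^\bullet\to B$; $(\to!)$: from $\sum_{i=1}^n(!A_i)^\bullet\to A$ infer $\sum_{i=1}^n(!A_i)^\bullet\to !A$; $(\mathrm{w})$: from $H\to B$ infer $H+(!A)^\bullet\to B$; $(\mathrm{c})$: from $H+2\cdot(!A)^\bullet\to B$ infer $H+(!A)^\bullet\to B$. *)

(* Defs.v *)
(* Mathematical Components *)
From mathcomp Require Import all_boot.

Set Implicit Arguments.
Unset Strict Implicit.
Unset Printing Implicit Defensive.

Local Open Scope quotient_scope.

(* Attachment and external sequences are arbitrary strings of nodes: repetitions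
   are allowed, so that hyperedge replacement may identify nodes of the host.
   Ranks are imposed separately, by [ranked]. *)
Record hgraph (L : Type) := HGraph {
  hV : finType;
  hE : finType;
  att : hE -> seq hV;
  lab : hE -> L;
  ext : seq hV
}.

Arguments HGraph {L}.

Section Hypergraphs.
Variable L : Type.
Implicit Types G H : hgraph L.

Definition rank G : nat := size (ext G).

Definition hempty : hgraph L :=
  HGraph void void (fun e => match e with end) (fun e => match e with end) [::].

(* The disjoint union is meaningful when [G] or [H] has rank 0; the
   concatenation below is then the external sequence of the other summand. *)
Definition hplus G H : hgraph L :=
  HGraph (hV G + hV H)%type (hE G + hE H)%type
    (fun e => match e with
              | inl e1 => map inl (att e1)
              | inr e2 => map inr (att e2)
              end)
    (fun e => match e with inl e1 => lab e1 | inr e2 => lab e2 end)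
    (map inl (ext G) ++ map inr (ext H)).

Definition hmul (k : nat) H : hgraph L := iter k (hplus H) hempty.

(* Simultaneous hyperedge replacement: every hyperedge [e] of [G] such that
   [K e = Some H] is removed and a disjoint copy of [H] is inserted, the i-th
   attachment node of [e] being fused with the i-th external node of [H]. It is
   meaningful when [H] has as many external nodes as [e] has attachment
   nodes. *)
Section Replacement.
Variables (G : hgraph L) (K : hE G -> option (hgraph L)).

Definition filler (e : hE G) : hgraph L := if K e is Some H then H else hempty.

Definition pre_node : finType := (hV G + {e : hE G & hV (filler e)})%type.

Definition fuse : rel pre_node := fun x y =>
  match x, y with
  | inl v, inr (existT e w) | inr (existT e w), inl v =>
      (v, w) \in zip (att e) (ext (filler e))
  | _, _ => false
  end.

Lemma fuse_sym : symmetric fuse.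
Proof. by move=> [v|[e w]] [v'|[e' w']]. Qed.

(* [connect fuse] is the smallest equivalence relation containing [fuse]. *)
Lemma connect_fuse_sym : symmetric (connect fuse).
Proof. exact: (sym_connect_sym fuse_sym). Qed.

Canonical fuse_equiv :=
  EquivRel (connect fuse) (connect0 fuse) connect_fuse_sym (@connect_trans _ fuse).

Definition node : finType := quot_type {eq_quot fuse_equiv}.

Definition host_node (v : hV G) : node := \pi_({eq_quot fuse_equiv}) (inl v).
Definition fill_node (e : hE G) (w : hV (filler e)) : node :=
  \pi_({eq_quot fuse_equiv}) (inr (Tagged (fun e => hV (filler e)) w)).

Definition repl : hgraph L :=
  HGraph node ({e : hE G | ~~ K e} + {e : hE G & hE (filler e)})%type
    (fun x => match x with
              | inl e => map host_node (att (val e))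
              | inr (existT e y) => map (@fill_node e) (att y)
              end)
    (fun x => match x with
              | inl e => lab (val e)
              | inr (existT e y) => lab y
              end)
    (map host_node (ext G)).

End Replacement.

(* G[e/H] *)
Definition repl1 G (e : hE G) H : hgraph L :=
  repl (fun e' => if e' == e then Some H else None).

End Hypergraphs.

Arguments repl {L} G K.
Arguments repl1 {L} G e H.

(* Isomorphism of hypergraphs, labels being compared by [R]. *)
Inductive hiso (L : Type) (R : L -> L -> Prop) (G H : hgraph L) : Prop :=
| HIso (f : hV G -> hV H) (g : hE G -> hE H) :
    bijective f -> bijective g ->
    (forall e, att (g e) = map f (att e)) ->
    (forall e, R (lab e) (lab (g e))) ->
    ext H = map f (ext G) ->
    hiso R G H.

Section Calculus.
Variables (P : Type) (prk : P -> nat).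

(* Types together with the auxiliary labels $_d; the genuine types are singled
   out by [is_type]. *)
Inductive label : Type :=
| Dollar (d : nat)
| Prim (p : P)
| Div (N : label) (D : hgraph label)
| Times (M : hgraph label)
| Bang (A : label).

Definition is_dollar (A : label) : bool := if A is Dollar _ then true else false.

Definition rk (A : label) : nat :=
  match A with
  | Dollar d => d
  | Prim p => prk p
  | Div _ D => if [pick e | is_dollar (lab (h := D) e)] is Some e
               then size (att e) else 0
  | Times M => rank M
  | Bang _ => 0
  end.

Definition ranked (G : hgraph label) : Prop :=
  forall e : hE G, size (att e) = rk (lab e).

Inductive is_type : label -> Prop :=
| type_prim p : is_type (Prim p)
| type_div N (D : hgraph label) (e0 : hE D) :
    is_type N -> ranked D -> rk N = rank D ->
    is_dollar (lab e0) ->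
    (forall e : hE D, e != e0 -> is_type (lab e)) ->
    is_type (Div N D)
| type_times (M : hgraph label) :
    ranked M -> (forall e : hE M, is_type (lab e)) -> is_type (Times M)
| type_bang A : is_type A -> rk A = 0 -> is_type (Bang A).

Definition typed (G : hgraph label) : Prop :=
  ranked G /\ forall e : hE G, is_type (lab e).

(* Isomorphic hypergraphs are not distinguished, also when they occur inside
   types: [same] is the induced identification of types. *)
Inductive same : label -> label -> Prop :=
| same_dollar d : same (Dollar d) (Dollar d)
| same_prim p : same (Prim p) (Prim p)
| same_div N N' D D' : same N N' -> hiso same D D' -> same (Div N D) (Div N' D')
| same_times M M' : hiso same M M' -> same (Times M) (Times M')
| same_bang A A' : same A A' -> same (Bang A) (Bang A').

Definition handle (A : label) : hgraph label :=
  HGraph 'I_(rk A) unit (fun _ => enum 'I_(rk A)) (fun _ => A) (enum 'I_(rk A)).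

Definition hsum_bang (As : seq label) : hgraph label :=
  foldr (fun A G => hplus (handle (Bang A)) G) (@hempty label) As.

(* [HMEL0 H A] : the sequent H -> A is derivable. The label carried by [e] in
   the context H[e/_] is immaterial: only its rank matters. *)
Inductive HMEL0 : hgraph label -> label -> Prop :=
| HMEL0_iso H H' A A' :
    hiso same H H' -> same A A' -> HMEL0 H A -> HMEL0 H' A'
| HMEL0_ax A : is_type A -> HMEL0 (handle A) A
| HMEL0_divL (H : hgraph label) (e : hE H) N (D : hgraph label) (e0 : hE D)
    (Hs : hE D -> hgraph label) A :
    is_type (Div N D) -> is_dollar (lab e0) ->
    typed H -> size (att e) = rk N ->
    HMEL0 (repl1 H e (handle N)) A ->
    (forall d : hE D, d != e0 -> HMEL0 (Hs d) (lab d)) ->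
    HMEL0 (repl1 H e
             (repl D (fun d => Some (if d == e0 then handle (Div N D) else Hs d))))
          A
| HMEL0_divR F N (D : hgraph label) (e0 : hE D) :
    is_type (Div N D) -> is_dollar (lab e0) ->
    typed F -> rank F = rk (Div N D) ->
    HMEL0 (repl1 D e0 F) N ->
    HMEL0 F (Div N D)
| HMEL0_timesR (M : hgraph label) (Hs : hE M -> hgraph label) :
    is_type (Times M) ->
    (forall m : hE M, HMEL0 (Hs m) (lab m)) ->
    HMEL0 (repl M (fun m => Some (Hs m))) (Times M)
| HMEL0_timesL (H : hgraph label) (e : hE H) M A :
    is_type (Times M) ->
    typed H -> size (att e) = rank M ->
    HMEL0 (repl1 H e M) A ->
    HMEL0 (repl1 H e (handle (Times M))) A
| HMEL0_bangL H A B :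
    is_type (Bang A) ->
    HMEL0 (hplus H (handle A)) B ->
    HMEL0 (hplus H (handle (Bang A))) B
| HMEL0_bangR (As : seq label) A :
    is_type (Bang A) ->
    HMEL0 (hsum_bang As) A ->
    HMEL0 (hsum_bang As) (Bang A)
| HMEL0_weak H A B :
    is_type (Bang A) ->
    HMEL0 H B ->
    HMEL0 (hplus H (handle (Bang A))) B
| HMEL0_contr H A B :
    is_type (Bang A) ->
    HMEL0 (hplus H (hmul 2 (handle (Bang A)))) B ->
    HMEL0 (hplus H (handle (Bang A))) B.

End Calculus.

(* Main.v *)
Require Import Defs.
From mathcomp Require Import all_boot.

(* Hypergraphs form a monad-like structure: substituting a hypergraph for every
   hyperedge is associative, with handles as units, so a context G[e/-] behaves
   as an operation. Call a replacement of U by W admissible when it preserves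
   derivability in every context; this is a preorder compatible with
   substitution, the left and structural rules assert instances of it, and cut
   on A says that the handle of A may be replaced by every K with K -> A.

   This is proved by structural induction on A, then by induction on the
   derivation of K -> A. If that derivation ends with a left rule, transitivity
   suffices. If it ends with a right rule, the handles of A are replaced by K
   simultaneously in all the sequents H -> B, by induction on the derivation of
   H -> B; replacing several copies at once takes care of contraction. When
   A = !A', the hypergraph K is then a sum of handles of types !A_i, hence it can
   itself be weakened and contracted, and is preserved by the rule (-> !). *)
Set Implicit Arguments.
Unset Strict Implicit.
Unset Printing Implicit Defensive.

Local Open Scope quotient_scope.

Local Notation "G ~= H" := (hiso (@same _) G H) (at level 70).

(** * Nodes of a replacement *)

Section NodeElim.
Variables (L : Type) (G : hgraph L) (K : hE G -> option (hgraph L)).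

Lemma host_node_fill e v (w : hV (filler K e)) :
  (v, w) \in zip (att e) (ext (filler K e)) ->
  host_node K v = fill_node w.
Proof.
move=> vw; apply/eqmodP => /=; apply: connect1.
by rewrite /fuse /=.
Qed.

Lemma node_cases (n : node K) :
  (exists v, n = host_node K v) \/
  (exists e (w : hV (filler K e)), n = fill_node w).
Proof.
rewrite -[n]reprK; case: (repr n) => [v|[e w]]; first by left; exists v.
by right; exists e, w.
Qed.

Variables (Z : Type) (a : hV G -> Z) (b : forall e, hV (filler K e) -> Z).
Hypothesis ab : forall e v (w : hV (filler K e)),
  (v, w) \in zip (att e) (ext (filler K e)) -> a v = b w.

Let pre (x : pre_node K) : Z :=
  match x with inl v => a v | inr (existT e w) => b w end.

(** The nodes of a replacement are the pushout of the host and its fillers along the attachments.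
    This is the map out of it induced by the cocone [(a, b)], computed on the canonical
    representative; compatibility makes it constant on fused nodes. *)
Definition node_rec (n : node K) : Z := pre (repr n).

Let pre_connect x y : connect (@fuse L G K) x y -> pre x = pre y.
Proof.
move=> /connectP[p]; elim: p x => [|z p IH] x /=; first by move=> _ ->.
move=> /andP[xz zp] /(IH _ zp) <-.
case: x z xz {zp} => [v|[e w]] [v'|[e' w']] //= vw; first exact: ab.
by rewrite (ab vw).
Qed.

Lemma node_rec_host v : node_rec (host_node K v) = a v.
Proof.
rewrite /node_rec -[RHS]/(pre (inl v)); apply: pre_connect.
by have /eqmodP := reprK (host_node K v).
Qed.

Lemma node_rec_fill e (w : hV (filler K e)) : node_rec (fill_node w) = b w.
Proof.
rewrite /node_rec -[RHS]/(pre (inr (Tagged (fun e => hV (filler K e)) w))).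
by apply: pre_connect; have /eqmodP := reprK (fill_node w).
Qed.

End NodeElim.

(** * Corresponding entries of attachment and external sequences *)

Section Zip.
Variables (S T : eqType).

Lemma zip_in_map (Z : Type) (a : S -> Z) (b : T -> Z) s t v w :
  map a s = map b t -> (v, w) \in zip s t -> a v = b w.
Proof.
elim: s t => [|x s IH] [|y t] //= [xy st]; rewrite inE.
by case/orP => [/eqP[-> ->]//|]; apply: IH.
Qed.

Lemma zip_map_in (S' T' : eqType) (f : S -> S') (g : T -> T') s t v w :
  (v, w) \in zip (map f s) (map g t) ->
  exists v0 w0, [/\ (v0, w0) \in zip s t, v = f v0 & w = g w0].
Proof.
elim: s t => [|x s IH] [|y t] //=; rewrite inE.
case/orP => [/eqP[-> ->]|/IH[v0 [w0 [i -> ->]]]].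
  by exists x, y; rewrite inE eqxx.
by exists v0, w0; rewrite inE i orbT.
Qed.

Lemma in_zip_map (S' T' : eqType) (f : S -> S') (g : T -> T') s t v w :
  (v, w) \in zip s t -> (f v, g w) \in zip (map f s) (map g t).
Proof.
elim: s t => [|x s IH] [|y t] //=; rewrite !inE.
by case/orP => [/eqP[-> ->]|/IH->]; rewrite ?eqxx ?orbT.
Qed.

End Zip.

(** * Identification of types *)

Section Same.
Variable P : Type.
Implicit Types A B : label P.
Implicit Types G H : hgraph (label P).

(** Labels are nested inside hypergraphs, so the induction hypothesis has to be supplied for every
    hyperedge label. The local function [recg] destructs the hypergraph so that these labels appear
    as subterms. *)
Fixpoint label_nested_ind (Q : label P -> Prop)
  (Qdollar : forall d, Q (Dollar P d)) (Qprim : forall p, Q (Prim p))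
  (Qdiv : forall N (D : hgraph (label P)),
     Q N -> (forall e : hE D, Q (lab e)) -> Q (Div N D))
  (Qtimes : forall M : hgraph (label P),
     (forall e : hE M, Q (lab e)) -> Q (Times M))
  (Qbang : forall A, Q A -> Q (Bang A)) A : Q A :=
  let rec := label_nested_ind Qdollar Qprim Qdiv Qtimes Qbang in
  let recg (G : hgraph (label P)) : forall e : hE G, Q (lab e) :=
    match G with HGraph V E a l x => fun e => rec (l e) end in
  match A with
  | Dollar d => Qdollar d
  | Prim p => Qprim p
  | Div N D => Qdiv N D (rec N) (recg D)
  | Times M => Qtimes M (recg M)
  | Bang B => Qbang B (rec B)
  end.

(** Here and in the next two lemmas the property of [same] is assumed only at the labels of [G],
    which is what the nested induction provides when [same] is shown to be an equivalence. *)
Lemma hiso_refl_on G : (forall e : hE G, same (lab e) (lab e)) -> G ~= G.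
Proof.
move=> hl; exists id id => //; try by exists id.
- by move=> e; rewrite map_id.
- by rewrite map_id.
Qed.

Lemma hiso_sym_on G H :
  (forall (e : hE G) B, same (lab e) B -> same B (lab e)) -> G ~= H -> H ~= G.
Proof.
move=> sym [f g [f' fK f'K] [g' gK g'K] ha hl he].
exists f' g'; [by exists f|by exists g| | |].
- by move=> e; rewrite -{2}(g'K e) ha mapK.
- by move=> e; apply: sym; rewrite -{2}(g'K e).
- by rewrite he mapK.
Qed.

Lemma hiso_trans_on G H J :
  (forall (e : hE G) B C, same (lab e) B -> same B C -> same (lab e) C) ->
  G ~= H -> H ~= J -> G ~= J.
Proof.
move=> trans [f g bf bg ha hl he] [f1 g1 bf1 bg1 ha1 hl1 he1].
exists (f1 \o f) (g1 \o g); [exact: bij_comp|exact: bij_comp| | |].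
- by move=> e; rewrite /= ha1 ha map_comp.
- by move=> e; apply: trans (hl e) (hl1 _).
- by rewrite he1 he map_comp.
Qed.

Lemma same_refl A : same A A.
Proof.
elim/label_nested_ind: A => *; constructor => //; exact: hiso_refl_on.
Qed.

Lemma same_sym A B : same A B -> same B A.
Proof.
elim/label_nested_ind: A B => [d|p|N D IN ID|M IM|A IA] B s; inversion s; subst;
  constructor; auto using hiso_sym_on.
Qed.

Lemma same_trans A B C : same A B -> same B C -> same A C.
Proof.
elim/label_nested_ind: A B C => [d|p|N D IN ID|M IM|A IA] B C s t;
  inversion s; subst; inversion t; subst; constructor; eauto using hiso_trans_on.
Qed.

(* [hiso] with its inverses as data, so that finite choice applies to families of
   isomorphisms. *)
Record giso G H : Type := GIso {
  giV : hV G -> hV H; giV' : hV H -> hV G;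
  giE : hE G -> hE H; giE' : hE H -> hE G;
  giVK : cancel giV giV'; giV'K : cancel giV' giV;
  giEK : cancel giE giE'; giE'K : cancel giE' giE;
  gi_att : forall e, att (giE e) = map giV (att e);
  gi_lab : forall e, same (lab e) (lab (giE e));
  gi_ext : ext H = map giV (ext G)
}.

Lemma hiso_giso G H : G ~= H -> inhabited (giso G H).
Proof.
by case=> f g [f' fK f'K] [g' gK g'K] ha hl he; constructor; exists f f' g g'.
Qed.

Lemma hiso_refl G : G ~= G.
Proof. by apply: hiso_refl_on => e; apply: same_refl. Qed.

Lemma hiso_sym G H : G ~= H -> H ~= G.
Proof. by apply: hiso_sym_on => e B; apply: same_sym. Qed.

Lemma hiso_trans G H J : G ~= H -> H ~= J -> G ~= J.
Proof. by apply: hiso_trans_on => e B C; apply: same_trans. Qed.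

Lemma hiso_rank G H : G ~= H -> rank G = rank H.
Proof. by case=> f g _ _ _ _ he; rewrite /rank he size_map. Qed.

End Same.

(** * Substitution for all hyperedges *)

Section Substitution.
Variables (P : Type) (prk : P -> nat).
Implicit Types A B l : label P.
Implicit Types G H X Y Z : hgraph (label P).

Local Notation rk := (rk prk).
Local Notation handle := (handle prk).

(* [repl G (fun e => Some (F e))] without its empty type of surviving hyperedges *)
Definition gsub G (F : hE G -> hgraph (label P)) : hgraph (label P) :=
  HGraph (node (fun e => Some (F e))) {e : hE G & hE (F e)}
    (fun x => let: existT e y := x in
       map (@fill_node _ G (fun e => Some (F e)) e) (att y))
    (fun x => let: existT e y := x in lab y)
    (map (host_node (fun e => Some (F e))) (ext G)).

Definition ghost G (F : hE G -> hgraph (label P)) (v : hV G) : hV (gsub F) :=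
  host_node (fun e => Some (F e)) v.

Definition gfill G (F : hE G -> hgraph (label P)) e (w : hV (F e)) :
  hV (gsub F) := @fill_node _ G (fun e => Some (F e)) e w.

Lemma ghost_fill G (F : hE G -> hgraph (label P)) e v (w : hV (F e)) :
  (v, w) \in zip (att e) (ext (F e)) -> ghost F v = gfill w.
Proof. exact: (@host_node_fill _ G (fun e => Some (F e))). Qed.

Lemma gsub_cases G (F : hE G -> hgraph (label P)) (n : hV (gsub F)) :
  (exists v, n = ghost F v) \/ (exists e (w : hV (F e)), n = gfill w).
Proof. exact: (@node_cases _ G (fun e => Some (F e))). Qed.

Definition grec G (F : hE G -> hgraph (label P)) :=
  @node_rec _ G (fun e => Some (F e)).

Lemma grec_ex G (F : hE G -> hgraph (label P)) (Z : Type) (a : hV G -> Z)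
    (b : forall e, hV (F e) -> Z) :
    (forall e v (w : hV (F e)), (v, w) \in zip (att e) (ext (F e)) ->
       a v = b e w) ->
  exists c : hV (gsub F) -> Z,
    (forall v, c (ghost F v) = a v) /\ (forall e w, c (@gfill G F e w) = b e w).
Proof.
move=> ab; exists (@grec G F Z a b); split=> *.
  exact: (node_rec_host (K := fun e => Some (F e))).
exact: (node_rec_fill (K := fun e => Some (F e))).
Qed.

Lemma att_gsub G (F : hE G -> hgraph (label P)) e (y : hE (F e)) :
  att (h := gsub F) (existT _ e y) = map (@gfill G F e) (att y).
Proof. by []. Qed.

(* The universal property of the node set of [gsub F] reduces an isomorphism
   with [X] to a compatible cocone [(h, k)] which is jointly surjective and
   through which the injections of [gsub F] factor. *)
Lemma gsub_iso G (F : hE G -> hgraph (label P)) X (h : hV G -> hV X)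
    (k : forall e, hV (F e) -> hV X) (u : hV X -> hV (gsub F))
    (g : hE (gsub F) -> hE X) :
    (forall e v (w : hV (F e)), (v, w) \in zip (att e) (ext (F e)) ->
       h v = k e w) ->
    (forall v, u (h v) = ghost F v) ->
    (forall e w, u (k e w) = gfill w) ->
    (forall x, (exists v, x = h v) \/ (exists e w, x = k e w)) ->
    bijective g ->
    (forall e (y : hE (F e)), att (g (existT _ e y)) = map (k e) (att y)) ->
    (forall e (y : hE (F e)), same (lab y) (lab (g (existT _ e y)))) ->
    ext X = map h (ext G) ->
  gsub F ~= X.
Proof.
move=> hk uh uk surj bg ha hl he.
have [c [ch ck]] := grec_ex hk.
exists c g => //.
- exists u.
    by move=> n; case: (gsub_cases n) => [[v ->]|[e [w ->]]]; rewrite ?ch ?ck.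
  by move=> x; case: (surj x) => [[v ->]|[e [w ->]]]; rewrite ?uh ?uk ?ch ?ck.
- by case=> e y; rewrite ha att_gsub -map_comp; apply: eq_map => w /=; rewrite ck.
- by case=> e y; apply: hl.
- by rewrite he /= -map_comp; apply: eq_map => v /=; rewrite ch.
Qed.

Lemma gsub_congr_fill G (F F' : hE G -> hgraph (label P)) :
  (forall e, F e ~= F' e) -> gsub F ~= gsub F'.
Proof.
move=> FF'.
have /fin_all_exists[i _] : forall e, exists i : giso (F e) (F' e), True.
  by move=> e; have [i] := hiso_giso (FF' e); exists i.
have [|u [uh uk]] :=
    @grec_ex G F' (hV (gsub F)) (ghost F) (fun e w => gfill (giV' (i e) w)).
  move=> e v w; rewrite (gi_ext (i e)) -[att e]map_id.
  case/zip_map_in => v0 [w0 [vw -> ->]]; rewrite (giVK (i e)).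
  exact: ghost_fill.
apply: (gsub_iso (h := ghost F') (k := fun e w => gfill (giV (i e) w))
  (u := u) (g := fun x : hE (gsub F) => let: existT e y := x in
     existT (fun e => hE (F' e)) e (giE (i e) y))).
- move=> e v w vw; apply: ghost_fill; rewrite (gi_ext (i e)) -[att e]map_id.
  exact: (in_zip_map id).
- exact: uh.
- by move=> e w; rewrite uk (giVK (i e)).
- move=> n; case: (gsub_cases n) => [[v ->]|[e [w ->]]]; first by left; exists v.
  by right; exists e, (giV' (i e) w); rewrite (giV'K (i e)).
- exists (fun x : hE (gsub F') => let: existT e y := x in
     existT (fun e => hE (F e)) e (giE' (i e) y)).
    by case=> e y; rewrite (giEK (i e)).
  by case=> e y; rewrite (giE'K (i e)).
- by move=> e y; rewrite att_gsub (gi_att (i e)) -map_comp.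
- by move=> e y; apply: gi_lab.
- by [].
Qed.

(** A family indexed by [E] is moved along the bijection [g] to one indexed by [E']. Since [e'] and
    [g (g' e')] are only propositionally equal, the definition casts along that equality. *)
Lemma bij_fibre_rec (E E' : eqType) (g : E -> E') (U : E' -> Type) (Z : Type)
    (b : forall e, U (g e) -> Z) :
  bijective g -> exists b' : forall e', U e' -> Z, forall e w, b' (g e) w = b e w.
Proof.
case=> g' gK g'K.
exists (fun e' =>
  match g'K e' in _ = e2 return U e2 -> Z with erefl => b (g' e') end).
move=> e w; move: (g'K (g e)) => p.
(* With [e1] generalised, injectivity of [g] turns the cast into one along a loop, which is trivial
   because equality on an [eqType] has unique proofs. *)
suff gen : forall e1 (p : g e1 = g e),
    match p in _ = e2 return U e2 -> Z with erefl => b e1 end w = b e w.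
  exact: gen.
move=> e1 q; have e1e := can_inj gK q; subst e1.
by rewrite (eq_axiomK q).
Qed.

(** Labels of the host do not survive in [gsub], so the host isomorphism concerns nodes and
    attachments only. *)
Lemma gsub_congr_host G G' (f : hV G -> hV G') (g : hE G -> hE G')
    (F : hE G' -> hgraph (label P)) :
    bijective f -> bijective g -> (forall e, att (g e) = map f (att e)) ->
    ext G' = map f (ext G) ->
  gsub (fun e => F (g e)) ~= gsub F.
Proof.
move=> bf bg ha he; case: (bf) => f' fK f'K; case: (bg) => g' gK g'K.
set F0 := fun e => F (g e).
have [b bE] := @bij_fibre_rec _ _ g (fun e => hV (F e)) (hV (gsub F0))
   (fun e w => gfill (F := F0) (e := e) w) bg.
have [y yE] := @bij_fibre_rec _ _ g (fun e => hE (F e)) (hE (gsub F0))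
   (fun e w => existT _ e w) bg.
have [|u [uh uk]] := @grec_ex G' F (hV (gsub F0)) (fun v => ghost F0 (f' v)) b.
  move=> e v; rewrite -(g'K e) => w; rewrite bE ha -[ext _]map_id.
  case/zip_map_in => v0 [w0 [vw -> ->]]; rewrite fK.
  exact: ghost_fill.
apply: (gsub_iso (h := fun v => ghost F (f v))
  (k := fun e (w : hV (F0 e)) => gfill (F := F) (e := g e) w) (u := u)
  (g := fun x : hE (gsub F0) => let: existT e y := x in
     existT (fun e => hE (F e)) (g e) y)).
- move=> e v w vw; apply: ghost_fill; rewrite ha -[ext _]map_id.
  exact: (in_zip_map f id).
- by move=> v; rewrite uh fK.
- by move=> e w; rewrite uk bE.
- move=> n; case: (gsub_cases n) => [[v ->]|[e [w ->]]].
    by left; exists (f' v); rewrite f'K.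
  by right; move: w; rewrite -(g'K e) => w; exists (g' e), w.
- exists (fun x : hE (gsub F) => let: existT e z := x in y e z).
    by case=> e z; rewrite yE.
  by case=> e; rewrite -(g'K e) => z; rewrite yE.
- by [].
- by move=> e z; apply: same_refl.
- by rewrite /= he -map_comp.
Qed.

(** For [s] an attachment sequence this is the node map that fusing a handle induces: the [i]-th
    node of the handle goes to the [i]-th attachment node. *)
Definition seq_fun (T : Type) (s : seq T) n (sz : n = size s) (i : 'I_n) : T :=
  tnth (in_tuple s) (cast_ord sz i).

Lemma map_seq_fun (T : Type) (s : seq T) n (sz : n = size s) :
  map (seq_fun sz) (enum 'I_n) = s.
Proof.
subst n; rewrite -[RHS](map_tnth_enum (in_tuple s)).
by apply: eq_map => i; rewrite /seq_fun cast_ord_id.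
Qed.

Lemma seq_fun_zip (T : eqType) (s : seq T) n (sz : n = size s) i :
  ((seq_fun sz i, i) \in zip s (enum 'I_n)) *
  ((i, seq_fun sz i) \in zip (enum 'I_n) s).
Proof.
have := map_seq_fun sz; move: (seq_fun sz) => f <-.
have: i \in enum 'I_n by rewrite mem_enum.
elim: (enum _) => //= x t IH; rewrite !inE.
by case/orP=> [/eqP->|/IH[-> ->]]; rewrite ?eqxx ?orbT.
Qed.

(** First unit law. Every node of a handle is external, hence fused with a host node when the ranks
    agree, so a handle contributes just its hyperedge. *)
Lemma gsub_handles G : ranked prk G -> gsub (fun e : hE G => handle (lab e)) ~= G.
Proof.
move=> rG; have rG' (e : hE G) : rk (lab e) = size (att e) by rewrite rG.
have cpt e v w : (v, w) \in zip (att e) (ext (handle (lab e))) ->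
    v = seq_fun (rG' e) w.
  by apply: (@zip_in_map _ _ _ id); rewrite map_id map_seq_fun.
pose F (e : hE G) := handle (lab e).
apply: (gsub_iso (F := F) (X := G) (h := id)
  (k := fun e (w : hV (F e)) => seq_fun (rG' e) w)
  (u := ghost F) (g := fun x : hE (gsub F) => let: existT e _ := x in e)) => //=.
- move=> e w; apply: (ghost_fill (F := F) (e := e)).
  by rewrite seq_fun_zip.
- by move=> x; left; exists x.
- by exists (fun e => existT _ e tt) => // -[e []].
- by move=> e _; rewrite map_seq_fun.
- by move=> e _; apply: same_refl.
- by rewrite map_id.
Qed.

(** Second unit law: the nodes of the host handle are all absorbed by the external nodes of [X]. *)
Lemma gsub_handle A X (F : hE (handle A) -> hgraph (label P)) :
  rank X = rk A -> F tt ~= X -> gsub F ~= X.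
Proof.
(* Passing to the constant family with value [X] lets the node and hyperedge maps be written without
   casts. *)
move=> rX FX; apply: (@hiso_trans _ _ (gsub (fun _ : hE (handle A) => X))).
  by apply: gsub_congr_fill => -[].
have rX' : rk A = size (ext X) by rewrite -rX.
pose F1 (_ : hE (handle A)) := X.
apply: (gsub_iso (F := F1) (X := X) (h := seq_fun rX') (k := fun e w => w)
  (u := gfill (F := F1) (e := tt))
  (g := fun x : hE (gsub F1) => let: existT _ y := x in y)) => //=.
- case=> v w; apply: (@zip_in_map _ _ _ (seq_fun rX') id).
  by rewrite map_id map_seq_fun.
- move=> v; apply/esym/(ghost_fill (F := F1) (e := tt)) => /=.
  by rewrite seq_fun_zip.
- by case.
- by move=> x; right; exists tt, x.
- by exists (fun y => existT (fun _ => hE X) tt y) => // -[[] y].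
- by case=> y; rewrite map_id.
- by case=> y; apply: same_refl.
- by rewrite map_seq_fun.
Qed.

(** Both sides glue the same pieces along the same attachments. The maps [h] and [u] between the
    node sets come from recursion on nodes, and [u] requires an inner recursion inside every
    filler. *)
Lemma gsub_assoc G (F : hE G -> hgraph (label P))
    (F' : forall e, hE (F e) -> hgraph (label P)) :
  gsub (fun x : hE (gsub F) => let: existT e y := x in F' e y) ~=
  gsub (fun e => gsub (F' e)).
Proof.
set Fo := fun x : hE (gsub F) => let: existT e y := x in F' e y.
set Fi := fun e => gsub (F' e).
have [|h [hh hf]] := @grec_ex G F (hV (gsub Fi)) (ghost Fi)
   (fun e w => gfill (F := Fi) (ghost (F' e) w)).
  move=> e v w vw; apply: ghost_fill; rewrite -[att e]map_id.
  exact: (in_zip_map id).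
(* The inner recursion, for each [e] separately; finite choice then collects the results into the
   family [ue]. *)
have ex_u e : exists c : hV (gsub (F' e)) -> hV (gsub Fo),
    (forall v, c (ghost (F' e) v) = ghost Fo (gfill v)) /\
    (forall y w, c (@gfill _ (F' e) y w) =
       gfill (F := Fo) (e := existT (fun e => hE (F e)) e y) w).
  apply: (@grec_ex (F e) (F' e) _ (fun w => ghost Fo (gfill w))
    (fun y w => gfill (F := Fo) (e := existT (fun e => hE (F e)) e y) w)).
  move=> y v w vw; apply: ghost_fill; rewrite att_gsub -[ext _]map_id.
  exact: (in_zip_map (@gfill _ F e) id).
have [ue ueP] := fin_all_exists ex_u.
have [|u [uh uf]] := @grec_ex G Fi (hV (gsub Fo)) (fun v => ghost Fo (ghost F v)) ue.
  move=> e v w; rewrite -[att e]map_id.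
  case/zip_map_in => v0 [w0 [vw -> ->]]; rewrite (proj1 (ueP e)).
  by congr (ghost _ _); apply: ghost_fill.
apply: (gsub_iso (h := h) (u := u)
  (k := fun x => match x return hV (Fo x) -> hV (gsub Fi) with
     existT e y => fun w => gfill (F := Fi) (e := e) (gfill (F := F' e) (e := y) w) end)
  (g := fun x : hE (gsub Fo) => match x with
     existT (existT e y) z => existT (fun e => hE (Fi e)) e
        (existT (fun y => hE (F' e y)) y z) end)).
- case=> e y v w; rewrite att_gsub -[ext _]map_id.
  case/zip_map_in => v0 [w0 [vw -> ->]]; rewrite hf.
  by congr (gfill _); apply: ghost_fill.
- move=> n; case: (gsub_cases n) => [[v ->]|[e [w ->]]].
    by rewrite hh uh.
  by rewrite hf uf (proj1 (ueP e)).
- by case=> e y w; rewrite uf (proj2 (ueP e)).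
- move=> n; case: (gsub_cases n) => [[v ->]|[e [w ->]]].
    by left; exists (ghost F v); rewrite hh.
  case: (gsub_cases w) => [[v ->]|[y [z ->]]].
    by left; exists (gfill v); rewrite hf.
  by right; exists (existT _ e y), z.
- exists (fun x : hE (gsub Fi) => match x with existT e (existT y z) =>
    existT (fun x => hE (Fo x)) (existT (fun e => hE (F e)) e y) z end).
    by case=> [[e y] z].
  by case=> e [y z].
- by case=> e y z; rewrite !att_gsub -map_comp.
- by case=> e y z; apply: same_refl.
- by rewrite /= -map_comp; apply: eq_map => v /=; rewrite -/(ghost F v) hh.
Qed.

End Substitution.

(** * Replacement as substitution *)

Section ReplAsSubst.
Variables (P : Type) (prk : P -> nat).
Implicit Types A B l : label P.
Implicit Types G H X Y Z : hgraph (label P).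
Implicit Types o : option (hgraph (label P)).

Local Notation rk := (rk prk).
Local Notation handle := (handle prk).

(* The [total_*] functions analyse [K e] as a parameter [o], which avoids casts
   along equations [K e = _] in the dependent types of [repl]. *)
Definition total l o := if o is Some H then H else handle l.
Definition opt_filler o := if o is Some H then H else hempty (label P).

Definition total_edge l o : hE (total l o) -> (~~ o) + hE (opt_filler o) :=
  match o with Some _ => inr | None => fun _ => inl isT end.

Definition total_edge_inv l o : (~~ o) + hE (opt_filler o) -> hE (total l o) :=
  match o return (~~ o) + hE (opt_filler o) -> hE (total l o) with
  | Some H => fun z : (~~ true) + hE H =>
      match z with inl p => match notF p with end | inr y => y end
  | None => fun _ => tt
  end.

Definition total_in l o : hV (opt_filler o) -> hV (total l o) :=
  match o with Some _ => id | None => fun w => match w with end end.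

Definition total_fun l o (S : finType) (s : seq S) (T : Type) (h : S -> T) :
    (~~ o -> rk l = size s) -> (hV (opt_filler o) -> T) -> hV (total l o) -> T :=
  match o with
  | Some _ => fun _ f w => f w
  | None => fun sz _ i => h (seq_fun (sz isT) i)
  end.

Lemma total_edgeK l o : cancel (@total_edge l o) (@total_edge_inv l o).
Proof. by case: o => [//|[]]. Qed.

Lemma total_edge_invK l o : cancel (@total_edge_inv l o) (@total_edge l o).
Proof.
case: o => [H|] [] //= p.
by congr inl; apply: bool_irrelevance.
Qed.

Lemma total_edgeP l o (S : finType) (s : seq S) (T : Type) (h : S -> T)
    (sz : ~~ o -> rk l = size s) (f : hV (opt_filler o) -> T)
    (y : hE (total l o)) :
  match total_edge y with
  | inl _ => map h s = map (total_fun h sz f) (att y) /\ lab y = l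
  | inr y' => map f (att y') = map (total_fun h sz f) (att y) /\ lab y = lab y'
  end.
Proof.
case: o sz f y => [H|] sz f y //=; split=> //.
by rewrite -{1}(map_seq_fun (sz isT)) -map_comp.
Qed.

Lemma total_fun_glue l o (S : finType) (s : seq S) (T : Type) (h : S -> T)
    (sz : ~~ o -> rk l = size s) (f : hV (opt_filler o) -> T) :
  (forall v w, (v, w) \in zip s (ext (opt_filler o)) -> h v = f w) ->
  forall v w, (v, w) \in zip s (ext (total l o)) -> h v = total_fun h sz f w.
Proof.
case: o sz f => [H|] sz f hf v w /= vw; first exact: hf.
congr h.
by apply: zip_in_map vw; rewrite map_id; apply/esym/map_seq_fun.
Qed.

Lemma total_in_zip l o (S : eqType) (s : seq S) v w :
  (v, w) \in zip s (ext (opt_filler o)) ->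
  (v, total_in l w) \in zip s (ext (total l o)).
Proof. by case: o w => [H //|[]]. Qed.

Lemma total_fun_comp l o (S : finType) (s : seq S) (T T' : Type) (h : S -> T)
    (sz : ~~ o -> rk l = size s) (f : hV (opt_filler o) -> T)
    (u : T -> T') (k : hV (total l o) -> T') :
  (forall w, u (f w) = k (total_in l w)) ->
  (forall v w, (v, w) \in zip s (ext (total l o)) -> u (h v) = k w) ->
  forall w, u (total_fun h sz f w) = k w.
Proof.
case: o sz f k => [H|] sz f k uf uh w /=; first by rewrite uf.
by apply: uh => /=; rewrite seq_fun_zip.
Qed.

Lemma total_fun_in l o (S : finType) (s : seq S) (T : Type) (h : S -> T)
    (sz : ~~ o -> rk l = size s) (f : hV (opt_filler o) -> T) w :
  total_fun h sz f (total_in l w) = f w.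
Proof. by case: o sz f w => [//|] ? ? []. Qed.

(** A surviving hyperedge amounts to one filled with its own handle, so partial replacement becomes
    total substitution. Ranks matter only at survivors, where a handle is inserted. *)
Lemma repl_gsub G (K : hE G -> option (hgraph (label P))) :
  (forall e, K e = None -> size (att e) = rk (lab e)) ->
  repl G K ~= gsub (fun e => total (lab e) (K e)).
Proof.
move=> rG; apply: hiso_sym; set F := fun e => _.
have sz e : ~~ K e -> rk (lab e) = size (att e) by move: (rG e); case: (K e) => // ->.
have glue e v (w : hV (F e)) (vw : (v, w) \in zip (att e) (ext (F e))) :=
  ghost_fill vw.
have ucpt e v (w : hV (filler K e)) : (v, w) \in zip (att e) (ext (filler K e)) ->
    ghost F v = gfill (F := F) (total_in (o := K e) (lab e) w).
  by move=> /(@total_in_zip (lab e) (K e))/glue.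
pose u := node_rec (K := K) (ghost F)
  (fun e w => gfill (F := F) (total_in (o := K e) (lab e) w)).
have uh v : u (host_node K v) = ghost F v by apply: node_rec_host ucpt _.
have uf e w : u (@fill_node _ G K e w) = gfill (F := F) (total_in (o := K e) (lab e) w).
  exact: (node_rec_fill ucpt).
apply: (gsub_iso (F := F) (X := repl G K) (h := host_node K)
  (k := fun e => total_fun (o := K e) (host_node K) (@sz e) (@fill_node _ G K e))
  (u := u) (g := fun x : hE (gsub F) => let: existT e y := x in
    match total_edge (o := K e) y with
    | inl p => inl (exist (fun e => ~~ K e) e p)
    | inr y' => inr (existT (fun e => hE (filler K e)) e y')
    end)).
- move=> e v w; apply: total_fun_glue => v0 w0; exact: host_node_fill.
- exact: uh.
- move=> e w; apply: total_fun_comp => [w0|v0 w0 vw]; first exact: uf.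
  by rewrite uh (glue e v0 w0 vw).
- move=> n; case: (node_cases n) => [[v ->]|[e [w ->]]]; first by left; exists v.
  by right; exists e, (total_in (o := K e) (lab e) w); rewrite total_fun_in.
- exists (fun x : hE (repl G K) => match x with
    | inl (exist e p) =>
        existT (fun e => hE (F e)) e (total_edge_inv (o := K e) (lab e) (inl p))
    | inr (existT e y) => existT _ e (total_edge_inv (o := K e) (lab e) (inr y))
    end).
    case=> e y; rewrite -{2}(total_edgeK (l := lab e) (o := K e) y).
    by case: (total_edge _).
  by case=> [[e p]|[e y]]; rewrite total_edge_invK.
- move=> e y; have := total_edgeP (host_node K) (@sz e) (@fill_node _ G K e) y.
  by case: (total_edge y) => ? [<-].
- move=> e y; have := total_edgeP (host_node K) (@sz e) (@fill_node _ G K e) y.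
  by case: (total_edge y) => ? [_ ->]; apply: same_refl.
- by [].
Qed.

(** Unlike in [repl1], the hyperedges other than [e] are filled at the same time, as happens when
    handles in the surrounding context are replaced too. *)
Definition plug G (e : hE G) X (F : hE G -> hgraph (label P)) e' :=
  if e' == e then X else F e'.

Lemma repl1_gsub G (e : hE G) X :
  (forall e', e' != e -> size (att e') = rk (lab e')) ->
  repl1 G e X ~= gsub (plug e X (fun e' => handle (lab e'))).
Proof.
move=> rG; apply: hiso_trans (repl_gsub _) _.
  by move=> e'; case: eqP => // /eqP/rG.
by apply: gsub_congr_fill => e'; rewrite /plug /total; case: ifP => _; apply: hiso_refl.
Qed.

Lemma repl_all_gsub G (F : hE G -> hgraph (label P)) :
  repl G (fun e => Some (F e)) ~= gsub F.
Proof. exact: repl_gsub. Qed.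

(** * Disjoint unions *)

Lemma hplus_congr G G' H H' : G ~= G' -> H ~= H' -> hplus G H ~= hplus G' H'.
Proof.
case=> f g [f' fK f'K] [g' gK g'K] ha hl he.
case=> f1 g1 [f1' f1K f1'K] [g1' g1K g1'K] ha1 hl1 he1.
exists
  (fun x : hV (hplus G H) =>
     match x with inl x => inl (f x) | inr x => inr (f1 x) end : hV (hplus G' H'))
  (fun x : hE (hplus G H) =>
     match x with inl x => inl (g x) | inr x => inr (g1 x) end : hE (hplus G' H')).
- by exists (fun x => match x with inl x => inl (f' x) | inr x => inr (f1' x) end);
    case=> x /=; congruence.
- by exists (fun x => match x with inl x => inl (g' x) | inr x => inr (g1' x) end);
    case=> x /=; congruence.
- by case=> e /=; rewrite (ha, ha1) -!map_comp.
- by case=> e /=.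
- by rewrite /= he he1 map_cat -!map_comp.
Qed.

Lemma hplusC G H : rank G = 0 -> hplus G H ~= hplus H G.
Proof.
move=> /size0nil eG.
exists (fun x : hV (hplus G H) => match x with inl x => inr x | inr x => inl x end :
         hV (hplus H G))
  (fun x : hE (hplus G H) => match x with inl x => inr x | inr x => inl x end :
         hE (hplus H G)).
- by exists (fun x => match x with inl x => inr x | inr x => inl x end); case.
- by exists (fun x => match x with inl x => inr x | inr x => inl x end); case.
- by case=> e /=; rewrite -!map_comp.
- by case=> e; apply: same_refl.
- by rewrite /= eG /= cats0 -map_comp.
Qed.

Lemma hplusA G H X : hplus G (hplus H X) ~= hplus (hplus G H) X.
Proof.
exists (fun x : hV (hplus G (hplus H X)) => match x with
   inl x => inl (inl x) | inr (inl x) => inl (inr x) | inr (inr x) => inr x end :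
         hV (hplus (hplus G H) X))
  (fun x : hE (hplus G (hplus H X)) => match x with
   inl x => inl (inl x) | inr (inl x) => inl (inr x) | inr (inr x) => inr x end :
         hE (hplus (hplus G H) X)).
- by exists (fun x => match x with
   inl (inl x) => inl x | inl (inr x) => inr (inl x) | inr x => inr (inr x) end);
   [case=> [|[]]|case=> [[]|]].
- by exists (fun x => match x with
   inl (inl x) => inl x | inl (inr x) => inr (inl x) | inr x => inr (inr x) end);
   [case=> [|[]]|case=> [[]|]].
- by case=> [e|[e|e]] /=; rewrite -!map_comp.
- by case=> [e|[e|e]]; apply: same_refl.
- by rewrite /= !map_cat -!map_comp catA.
Qed.

Lemma hplus0 G : hplus G (hempty _) ~= G.
Proof.
exists
  (fun x : hV (hplus G (hempty _)) =>
     match x with inl x => x | inr x => match x with end end)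
  (fun x : hE (hplus G (hempty _)) =>
     match x with inl x => x | inr x => match x with end end).
- by exists inl => // -[|[]].
- by exists inl => // -[|[]].
- by case=> [e|[]] /=; rewrite -map_comp map_id.
- by case=> [e|[]]; apply: same_refl.
- by rewrite /= cats0 -map_comp map_id.
Qed.

Lemma gsub_hplus G H (F : hE (hplus G H) -> hgraph (label P)) :
  gsub F ~= hplus (gsub (fun e => F (inl e))) (gsub (fun e => F (inr e))).
Proof.
set Fl := fun e => F (inl e); set Fr := fun e => F (inr e).
have [|ul [ulh ulf]] := @grec_ex _ G Fl (hV (gsub F)) (fun v => ghost F (inl v))
   (fun e w => gfill (F := F) (e := inl e) w).
  move=> e v w vw; apply: ghost_fill; rewrite /= -[ext _]map_id.
  exact: (in_zip_map _ id).
have [|ur [urh urf]] := @grec_ex _ H Fr (hV (gsub F)) (fun v => ghost F (inr v))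
   (fun e w => gfill (F := F) (e := inr e) w).
  move=> e v w vw; apply: ghost_fill; rewrite /= -[ext _]map_id.
  exact: (in_zip_map _ id).
apply: (gsub_iso (F := F) (X := hplus (gsub Fl) (gsub Fr))
  (h := fun v : hV (hplus G H) =>
     match v with inl v => inl (ghost Fl v) | inr v => inr (ghost Fr v) end)
  (k := fun e => match e return hV (F e) -> hV (hplus (gsub Fl) (gsub Fr)) with
     | inl e => fun w => inl (gfill (F := Fl) (e := e) w)
     | inr e => fun w => inr (gfill (F := Fr) (e := e) w) end)
  (u := fun x : hV (hplus (gsub Fl) (gsub Fr)) =>
     match x with inl n => ul n | inr n => ur n end)
  (g := fun x : hE (gsub F) => match x with
     | existT (inl e) y => inl (existT (fun e => hE (Fl e)) e y)
     | existT (inr e) y => inr (existT (fun e => hE (Fr e)) e y) end)).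
- case=> e v w; rewrite /= -[ext _]map_id.
    case/zip_map_in => v0 [w0 [vw -> ->]]; congr inl.
    exact: (ghost_fill (F := Fl)).
  case/zip_map_in => v0 [w0 [vw -> ->]]; congr inr.
  exact: (ghost_fill (F := Fr)).
- by case=> v; rewrite (ulh, urh).
- by case=> e w; rewrite (ulf, urf).
- case=> n; case: (gsub_cases n) => [[v ->]|[e [w ->]]].
  + by left; exists (inl v).
  + by right; exists (inl e), w.
  + by left; exists (inr v).
  + by right; exists (inr e), w.
- exists (fun x : hE (hplus (gsub Fl) (gsub Fr)) => match x with
     | inl (existT e y) => existT (fun e => hE (F e)) (inl e) y
     | inr (existT e y) => existT (fun e => hE (F e)) (inr e) y end).
    by case=> [[e|e] y].
  by case=> [[e y]|[e y]].
- by case=> e y; rewrite /= -map_comp.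
- by case=> e y; apply: same_refl.
- by rewrite /= map_cat -!map_comp.
Qed.

Definition hdel G (e : hE G) : hgraph (label P) :=
  HGraph (hV G) {e' : hE G | e' != e} (fun x => att (val x))
    (fun x => lab (val x)) (ext G).

(** A hyperedge of rank 0 touches no node, so the host is the disjoint union of [hdel e] and a
    handle without nodes; substitution distributes over this union. *)
Lemma gsub_hdel G (e : hE G) (F : hE G -> hgraph (label P)) :
  att e = [::] -> rk (lab e) = 0 -> rank (F e) = 0 ->
  gsub F ~= hplus (gsub (fun x : hE (hdel e) => F (val x))) (F e).
Proof.
move=> ae re rF; set G' := hplus (hdel e) (handle (lab e)).
have no (i : 'I_(rk (lab e))) : False by case: i; rewrite re.
have en : ext (handle (lab e)) = [::].
  by apply: size0nil; apply: etrans re; apply: size_enum_ord.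
pose f (x : hV G') : hV G :=
  match x with inl x => x | inr i => match no i with end end.
pose g (x : hE G') : hE G := match x with inl x => val x | inr _ => e end.
apply: (@hiso_trans _ _ (gsub (fun x => F (g x)))).
  apply/hiso_sym/(gsub_congr_host (f := f)).
  - exists inl => // -[] // i; by case: (no i).
  - exists (fun e' : hE G => if insub e' is Some x then inl x else inr tt).
      case=> [x|[]] /=; first by rewrite valK.
      by rewrite insubN ?eqxx.
    by move=> e'; case: insubP => [x _ <-|/negPn/eqP->].
  - case=> [e'|[]] /=; first by rewrite -map_comp map_id.
    by rewrite ae -[RHS]/(map f (map inr (ext (handle (lab e))))) en.
  - rewrite -[RHS]/(map f (map inl (ext G) ++ map inr (ext (handle (lab e))))) en.
    by rewrite cats0 -map_comp map_id.
apply: hiso_trans (gsub_hplus _) _; apply: hplus_congr; first exact: hiso_refl.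
by apply: gsub_handle; [rewrite rF re | apply: hiso_refl].
Qed.

Lemma gsub_hempty (F : hE (hempty (label P)) -> hgraph (label P)) :
  gsub F ~= hempty _.
Proof.
apply: hiso_trans (gsub_handles (prk := prk) (G := hempty _) _).
  by apply: gsub_congr_fill => -[].
by case.
Qed.

End ReplAsSubst.

(** * Cut elimination *)

Section CutElimination.
Variables (P : Type) (prk : P -> nat).
Implicit Types A B l N : label P.
Implicit Types D G H K M U W X Y Z : hgraph (label P).

Local Notation rk := (rk prk).
Local Notation handle := (handle prk).
Local Notation is_type := (is_type prk).
Local Notation typed := (typed prk).
Local Notation HMEL0 := (HMEL0 prk).

(** * Well-formedness of types and of derivable sequents *)

Lemma is_type_div N D (e0 : hE D) : is_type (Div N D) -> is_dollar (lab e0) ->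
  [/\ is_type N, ranked prk D, rk N = rank D,
      forall e : hE D, e != e0 -> is_type (lab e) &
      rk (Div N D) = size (att e0)].
Proof.
move=> t; inversion t as [|N' D' e1 tN rD rN d1 tD| |]; subst => d0.
(* No type is a dollar, so the dollar hyperedge is unique and the [pick] in [rk] must return
   [e0]. *)
have uniq e : is_dollar (lab e) -> e = e1.
  move=> de; case: (eqVneq e e1) => // /tD te.
  by case: (lab e) te de => // d td; inversion td.
split=> //; first by rewrite (uniq _ d0).
rewrite /=; case: pickP => [e /uniq->|/(_ e0)]; rewrite ?(uniq _ d0) //.
by rewrite -(uniq _ d0) d0.
Qed.

Lemma is_type_times M : is_type (Times M) -> typed M.
Proof. by move=> t; inversion t; subst. Qed.

Lemma is_type_bang A : is_type (Bang A) -> is_type A /\ rk A = 0.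
Proof. by move=> t; inversion t; subst. Qed.

Lemma same_dollarE A B : same A B -> is_dollar A = is_dollar B.
Proof. by case. Qed.

(** Typing and rank are carried through one induction: the rank of a division is invariant only
    because typing makes its dollar hyperedge unique, while typing of the image uses the ranks of
    the inner labels. *)
Lemma same_type A B : same A B -> is_type A -> is_type B /\ rk B = rk A.
Proof.
elim/label_nested_ind: A B => [d|p|N D IN ID|M IM|A IA] B s; inversion s; subst => t //.
- have [e0 d0] : exists e0 : hE D, is_dollar (lab e0).
    by inversion t; subst; exists e0.
  have [tN rD rN tD rt] := is_type_div t d0.
  case: H3 => f g bf bg ha hl he; have [g' gK g'K] := bg.
  have d0' : is_dollar (lab (g e0)) by rewrite -(same_dollarE (hl e0)).
  have rl e : rk (lab (g e)) = rk (lab e).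
    case: (eqVneq e e0) => [->|/tD te]; last by case: (ID _ _ (hl e) te).
    by move: (hl e0) d0; case.
  have [tN' rN'] := IN _ H1 tN.
  have t' : is_type (Div N' D').
    apply: (type_div (e0 := g e0)) => //.
    - by move=> e; rewrite -(g'K e) ha size_map rl.
    - by rewrite rN' rN /rank he size_map.
    - move=> e; rewrite -(g'K e) (inj_eq (can_inj gK)) => /tD te.
      by case: (ID _ _ (hl _) te).
  split=> //; have [_ _ _ _ ->] := is_type_div t' d0'.
  by rewrite rt ha size_map.
- have [rM tM] := is_type_times t.
  case: H0 => f g bf bg ha hl he; have [g' gK g'K] := bg.
  split; last by rewrite /= /rank he size_map.
  constructor=> e; rewrite -(g'K e); have [] := IM _ _ (hl (g' e)) (tM _) => //.
  by rewrite ha size_map => _ ->.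
- have [tA rA] := is_type_bang t; have [tA' rA'] := IA _ H0 tA.
  by split=> //; constructor=> //; rewrite rA'.
Qed.

Lemma typed_iso G H : G ~= H -> typed G -> typed H.
Proof.
case=> f g bf [g' gK g'K] ha hl he [rG tG].
split=> e; rewrite -(g'K e); have [t r] := same_type (hl (g' e)) (tG _) => //.
by rewrite ha size_map r.
Qed.

Lemma rank_handle A : rank (handle A) = rk A.
Proof. exact: size_enum_ord. Qed.

Lemma typed_handle A : is_type A -> typed (handle A).
Proof. by move=> tA; split=> e //; apply: size_enum_ord. Qed.

Lemma handle_iso A B : same A B -> is_type A -> handle A ~= handle B.
Proof.
move=> s tA; have [_ r] := same_type s tA; rewrite /Defs.handle r.
(* The common rank is fixed in [h], so that both handles have the same node type and identities
   serve as the isomorphism. *)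
pose h (C : label P) := @HGraph (label P) 'I_(rk A) unit
  (fun _ => enum 'I_(rk A)) (fun _ => C) (enum 'I_(rk A)).
apply: (@HIso _ _ (h A) (h B) id id) => //=; try (by exists id).
- by move=> _; rewrite map_id.
- by rewrite map_id.
Qed.

Lemma rank_gsub G (F : hE G -> hgraph (label P)) : rank (gsub F) = rank G.
Proof. by rewrite /rank size_map. Qed.

Lemma typed_gsub G (F : hE G -> hgraph (label P)) :
  typed (gsub F) <-> forall e, typed (F e).
Proof.
split=> [[rF tF] e|tF].
  split=> y; last exact: (tF (existT _ e y)).
  by rewrite -(rF (existT _ e y)) size_map.
split=> -[e y]; have [r t] := tF e; last exact: t.
by rewrite size_map; apply: r.
Qed.

Lemma typed_hplus G H : typed (hplus G H) <-> typed G /\ typed H.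
Proof.
split=> [[r t]|[[rG tG] [rH tH]]].
  split; split=> e.
  - by rewrite -(r (inl e)) /= size_map.
  - exact: (t (inl e)).
  - by rewrite -(r (inr e)) /= size_map.
  - exact: (t (inr e)).
by split=> -[] e //=; rewrite size_map.
Qed.

Lemma typed_hempty : typed (hempty _).
Proof. by split; case. Qed.

Lemma rank_hplus G H : rank (hplus G H) = rank G + rank H.
Proof. by rewrite /rank /= size_cat !size_map. Qed.

Lemma typed_plug H (e : hE H) Z (F : hE H -> hgraph (label P)) :
  typed Z -> (forall e', e' != e -> typed (F e')) -> typed (gsub (plug e Z F)).
Proof.
by move=> tZ tF; apply/typed_gsub => e'; rewrite /plug; case: eqVneq => // /tF.
Qed.

Lemma repl1_plug G (e : hE G) X : typed G ->
  repl1 G e X ~= gsub (plug e X (fun e' => handle (lab e'))).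
Proof. by case=> rG _; apply: repl1_gsub. Qed.

Lemma plug_congr H (e : hE H) Z Z' (F F' : hE H -> hgraph (label P)) :
  Z ~= Z' -> (forall e', e' != e -> F e' ~= F' e') ->
  gsub (plug e Z F) ~= gsub (plug e Z' F').
Proof.
move=> ZZ FF; apply: gsub_congr_fill => e'; rewrite /plug.
by case: eqVneq => // /FF.
Qed.

Lemma repl1_congr G (e : hE G) Z Z' : typed G -> Z ~= Z' ->
  repl1 G e Z ~= repl1 G e Z'.
Proof.
move=> tG ZZ; apply: hiso_trans (repl1_plug _ _ tG) _.
apply: hiso_trans (hiso_sym (repl1_plug _ _ tG)).
by apply: plug_congr => // *; apply: hiso_refl.
Qed.

Lemma typed_repl1 G (e : hE G) Z : typed G -> typed Z -> typed (repl1 G e Z).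
Proof.
move=> tG tZ; apply: typed_iso (hiso_sym (repl1_plug _ _ tG)) _.
by apply: typed_plug => // e' _; apply: typed_handle; case: tG.
Qed.

Lemma rank_repl1 G (e : hE G) Z : rank (repl1 G e Z) = rank G.
Proof. by rewrite /rank size_map. Qed.

Lemma rank_hsum As : rank (hsum_bang prk As) = 0.
Proof. by elim: As => //= A As IH; rewrite rank_hplus IH rank_handle. Qed.

Lemma HMEL0_typed H A : HMEL0 H A -> [/\ typed H, is_type A & rank H = rk A].
Proof.
elim=> {H A}.
- move=> H H' A A' HH AA _ [tH tA r]; have [tA' rA'] := same_type AA tA.
  by split=> //; [apply: typed_iso HH tH|rewrite rA' -r (hiso_rank HH)].
- by move=> A tA; split=> //; [apply: typed_handle|rewrite rank_handle].
- move=> H e N D e0 Hs A t d0 tH sz _ [_ tA r] _ IH.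
  split=> //; last by rewrite -r !rank_repl1.
  apply: typed_repl1 => //; apply: typed_iso (hiso_sym (repl_all_gsub prk _)) _.
  apply/typed_gsub => d; case: eqVneq => [_|/IH[]//]; exact: typed_handle.
- by [].
- move=> M Hs t _ IH; split=> //; last by rewrite /rank size_map.
  apply: typed_iso (hiso_sym (repl_all_gsub prk _)) _.
  by apply/typed_gsub => d; have [] := IH d.
- move=> H e M A t tH sz _ [_ tA r].
  split=> //; last by rewrite -r !rank_repl1.
  by apply: typed_repl1 => //; apply: typed_handle.
- move=> H A B t _ [/typed_hplus[tH _] tB]; have [_ rA] := is_type_bang t.
  rewrite rank_hplus rank_handle rA => <-.
  split=> //; last by rewrite rank_hplus rank_handle.
  by apply/typed_hplus; split=> //; apply: typed_handle.
- by move=> As A t _ [tH _ r]; split=> //; rewrite rank_hsum.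
- move=> H A B t _ [tH tB r]; split=> //.
    by apply/typed_hplus; split=> //; apply: typed_handle.
  by rewrite rank_hplus rank_handle -r addn0.
- move=> H A B t _ [/typed_hplus[tH _] tB r]; split=> //.
    by apply/typed_hplus; split=> //; apply: typed_handle.
  by rewrite -r !rank_hplus !rank_handle.
Qed.

(* A type of every rank exists even if there are no primitive types; it labels
   the hole of a context. *)
Definition dummy r : label P :=
  Times (HGraph 'I_r void (fun e => match e with end) (fun e => match e with end)
    (enum 'I_r)).

Lemma dummy_type r : is_type (dummy r).
Proof. by constructor; case. Qed.

Lemma rk_dummy r : rk (dummy r) = r.
Proof. exact: size_enum_ord. Qed.

(* [C] is, up to isomorphism, a context G[e/-] of rank [s] with a hole of rank [r]. *)
Definition ctx r s (C : hgraph (label P) -> hgraph (label P)) :=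
  exists G (e : hE G), [/\ typed G, size (att e) = r, rank G = s &
    forall Z, rank Z = r -> C Z ~= repl1 G e Z].

Lemma ctx_rank r s C Z : ctx r s C -> rank Z = r -> rank (C Z) = s.
Proof. by case=> G [e [_ _ <- CG]] /CG/hiso_rank->; rewrite rank_repl1. Qed.

Lemma ctx_typed r s C Z : ctx r s C -> rank Z = r -> typed Z -> typed (C Z).
Proof.
case=> G [e [tG _ _ CG]] /CG/hiso_sym i tZ; apply: typed_iso i _.
exact: typed_repl1.
Qed.

Lemma ctx_congr r s C Z Z' : ctx r s C -> rank Z = r -> Z ~= Z' -> C Z ~= C Z'.
Proof.
case=> G [e [tG _ _ CG]] rZ ZZ; have rZ' : rank Z' = r by rewrite -(hiso_rank ZZ).
apply: hiso_trans (CG _ rZ) _; apply: hiso_trans (hiso_sym (CG _ rZ')).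
exact: repl1_congr.
Qed.

Lemma ctx_iso r s C C' : (forall Z, rank Z = r -> C' Z ~= C Z) ->
  ctx r s C -> ctx r s C'.
Proof.
move=> CC [G [e [tG sz rG CG]]]; exists G, e; split=> // Z rZ.
exact: hiso_trans (CC _ rZ) (CG _ rZ).
Qed.

Lemma ctx_repl1 G (e : hE G) : typed G -> ctx (size (att e)) (rank G) (repl1 G e).
Proof. by move=> tG; exists G, e; split=> // Z _; apply: hiso_refl. Qed.

(** By associativity the host of the composite context is [H] with [K] put at [e], and its hole is
    the copy of [k]. The unit law restores the fillers away from [e]. *)
Lemma ctx_nest H (e : hE H) (F : hE H -> hgraph (label P)) K (k : hE K) :
  typed K -> (forall e', e' != e -> typed (F e')) ->
  ctx (size (att k)) (rank H) (fun Z => gsub (plug e (repl1 K k Z) F)).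
Proof.
move=> tK tF; pose F1 := plug e K F.
(* [F1 e] is [K] only after evaluating a test, so the copy [y] of [k] is found by generalising over
   a hypergraph equal to [K]. *)
have [y [sz yZ]] : exists y : hE (F1 e), size (att y) = size (att k) /\
    forall Z, repl1 (F1 e) y Z = repl1 K k Z.
  suff gen : forall X, X = K -> exists y : hE X, size (att y) = size (att k) /\
    forall Z, repl1 X y Z = repl1 K k Z by apply: gen; rewrite /F1 /plug eqxx.
  by move=> X ->; exists k.
have tF1 e' : typed (F1 e') by rewrite /F1 /plug; case: eqVneq => // /tF.
have tG : typed (gsub F1) by apply/typed_gsub.
exists (gsub F1), (existT (fun e => hE (F1 e)) e y).
split=> //; [by rewrite size_map|exact: rank_gsub|move=> Z rZ].
pose F2 e' (y' : hE (F1 e')) := @plug P (gsub F1) (existT (fun e => hE (F1 e)) e y) Z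
  (fun x => handle (lab (h := gsub F1) x)) (existT (fun e => hE (F1 e)) e' y').
apply/hiso_sym/(hiso_trans (repl1_plug _ _ tG)).
apply: (@hiso_trans _ _ (gsub (fun e' => gsub (F2 e')))).
  apply: hiso_trans (gsub_assoc F2).
  by apply: gsub_congr_fill => -[e' y']; apply: hiso_refl.
apply: gsub_congr_fill => e'; rewrite [X in _ ~= X]/plug; case: eqVneq => [->|ne].
  rewrite -yZ; apply/hiso_sym/(hiso_trans (repl1_plug _ _ (tF1 e))).
  by apply: gsub_congr_fill => y'; rewrite /F2 /plug /= eq_Tagged; apply: hiso_refl.
have -> : F e' = F1 e' by rewrite /F1 /plug (negPf ne).
apply: hiso_trans (gsub_handles (proj1 (tF1 e'))).
apply: gsub_congr_fill => y'; rewrite /F2 /plug /=.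
by case: eqP => [[/eqP]|_]; [rewrite (negPf ne)|apply: hiso_refl].
Qed.

Lemma repl1_handle A Z : is_type A -> rank Z = rk A ->
  @repl1 _ (handle A) tt Z ~= Z.
Proof.
move=> tA rZ; apply: hiso_trans (repl1_plug _ _ (typed_handle tA)) _.
by apply: gsub_handle => //; apply: hiso_refl.
Qed.

Lemma ctx_id r : ctx r r id.
Proof.
have := @ctx_repl1 (handle (dummy r)) tt (typed_handle (dummy_type r)).
rewrite [size _]size_enum_ord [rank _]size_enum_ord rk_dummy.
apply: ctx_iso => Z rZ; apply/hiso_sym/repl1_handle; rewrite ?rk_dummy //.
exact: dummy_type.
Qed.

(** The case of [ctx_nest] where the inner context is a lone hole with a dummy label. Typing is
    asked of the fillers, so that [H] may be the hypergraph of a division, dollar included. *)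
Lemma ctx_plug H (e : hE H) (F : hE H -> hgraph (label P)) :
  (forall e', e' != e -> typed (F e')) ->
  ctx (size (att e)) (rank H) (fun Z => gsub (plug e Z F)).
Proof.
move=> tF; set r := size _.
have := ctx_nest (K := handle (dummy r)) tt (typed_handle (dummy_type r)) tF.
rewrite [size _]size_enum_ord rk_dummy.
apply: ctx_iso => Z rZ; apply: plug_congr => [|e' _]; last exact: hiso_refl.
by apply/hiso_sym/repl1_handle; rewrite ?rk_dummy //; exact: dummy_type.
Qed.

Lemma ctx_comp r s t C C' : ctx r s C' -> ctx s t C -> ctx r t (fun Z => C (C' Z)).
Proof.
move=> cC' cC; have [G' [e' [tG' sz' rG' CG']]] := cC'.
have [G [e [tG sz rG CG]]] := cC.
have tF e1 : e1 != e -> typed (handle (lab e1)).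
  by move=> _; apply: typed_handle; case: tG.
have := ctx_nest e' tG' tF; rewrite sz' rG; apply: ctx_iso => Z rZ.
have rC := ctx_rank cC' rZ.
apply: hiso_trans (CG _ rC) _; apply: hiso_trans (repl1_plug _ _ tG) _.
by apply: plug_congr => [|e1 _]; [apply: CG'|apply: hiso_refl].
Qed.

Lemma ctx_hplus H : typed H -> ctx 0 (rank H) (hplus H).
Proof.
move=> tH; pose G := hplus H (handle (dummy 0)).
have tG : typed G.
  by apply/typed_hplus; split=> //; apply/typed_handle/dummy_type.
exists G, (inr tt); split=> //.
- exact: etrans (size_map _ _) (etrans (size_enum_ord _) (rk_dummy 0)).
- by rewrite rank_hplus rank_handle rk_dummy addn0.
move=> Z rZ; apply/hiso_sym/(hiso_trans (repl1_plug _ _ tG)).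
apply: hiso_trans (gsub_hplus _) _; apply: hplus_congr.
  by apply: gsub_handles; case: tH.
by apply: gsub_handle; [rewrite rk_dummy|apply: hiso_refl].
Qed.

(** Deleting the hole yields [H], by [gsub_hdel]. This is how the exponential and structural rules,
    stated for disjoint unions, act in arbitrary contexts. *)
Lemma ctx0_hplus s C : ctx 0 s C ->
  exists H, [/\ typed H, rank H = s & forall Z, rank Z = 0 -> C Z ~= hplus H Z].
Proof.
case=> G [e [tG /size0nil ae rG CG]].
exists (hdel e); split=> // [|Z rZ].
  by case: tG => r t; split=> -[e' ne]; [apply: r|apply: t].
apply: hiso_trans (CG _ rZ) _; apply: hiso_trans (repl1_plug _ _ tG) _.
have re : rk (lab e) = 0 by case: tG => <-; rewrite ae.
apply: hiso_trans (gsub_hdel ae re _) _; rewrite /plug eqxx //.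
apply: hplus_congr; last exact: hiso_refl.
apply: (@hiso_trans _ _ (gsub (fun x : hE (hdel e) => handle (lab x)))).
  by apply: gsub_congr_fill => -[x /= /negPf->]; apply: hiso_refl.
by apply: gsub_handles => -[x ne]; case: tG => r _; apply: r.
Qed.

(** * Admissible replacements *)

Lemma HMEL0_hiso H H' A : H ~= H' -> HMEL0 H A -> HMEL0 H' A.
Proof. by move=> HH; apply: HMEL0_iso HH (same_refl A). Qed.

(* Replacing [U] by [W] is admissible. *)
Definition red U W := [/\ typed U, typed W, rank U = rank W &
  forall s C B, ctx (rank U) s C -> HMEL0 (C U) B -> HMEL0 (C W) B].

Lemma red_refl U : typed U -> red U U.
Proof. by []. Qed.

Lemma red_trans U V W : red U V -> red V W -> red U W.
Proof.
move=> [tU tV r UV] [_ tW r' VW]; split=> //; first by rewrite r.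
by move=> s C B cC /(UV _ _ _ cC); apply: VW; rewrite -r; exact: cC.
Qed.

Lemma red_iso U U' W W' : U ~= U' -> W ~= W' -> red U W -> red U' W'.
Proof.
move=> UU WW [tU tW r UW]; split.
- exact: typed_iso UU tU.
- exact: typed_iso WW tW.
- by rewrite -(hiso_rank UU) r (hiso_rank WW).
move=> s C B; rewrite -(hiso_rank UU) => cC CU.
apply: HMEL0_hiso (ctx_congr cC (esym r) WW) _; apply: (UW _ _ _ cC).
by apply: HMEL0_hiso CU; apply: hiso_sym; apply: ctx_congr cC _ UU.
Qed.

Lemma red_ctx U W s C : red U W -> ctx (rank U) s C -> red (C U) (C W).
Proof.
move=> [tU tW r UW] cC; split.
- exact: ctx_typed cC _ tU.
- by apply: ctx_typed cC _ tW.
- by rewrite (ctx_rank cC) // (ctx_rank cC).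
move=> t C' B; rewrite (ctx_rank cC) // => cC'.
exact: UW (ctx_comp cC cC').
Qed.

Lemma red_HMEL0 U W B : red U W -> HMEL0 U B -> HMEL0 W B.
Proof. by case=> _ _ _ UW; apply: UW (ctx_id _). Qed.

(** The fillers are exchanged one at a time, each in the context formed by all the others. *)
Lemma red_gsub H (F F' : hE H -> hgraph (label P)) :
  (forall e, red (F e) (F' e)) -> (forall e, rank (F e) = size (att e)) ->
  red (gsub F) (gsub F').
Proof.
move=> FF rF; have tF e : typed (F e) by have [] := FF e.
have tF' e : typed (F' e) by have [] := FF e.
(* Invariant: exactly the fillers at the hyperedges of [s] have been exchanged. The full enumeration
   gives the claim. *)
suff mix (s : seq (hE H)) :
    red (gsub F) (gsub (fun e => if e \in s then F' e else F e)).
  apply: red_iso (mix (enum (hE H))); first exact: hiso_refl.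
  by apply: gsub_congr_fill => e; rewrite mem_enum; apply: hiso_refl.
elim: s => [|x s IH]; first by apply: red_refl; apply/typed_gsub.
apply: red_trans IH _; set F1 := fun e => if e \in s then _ else _.
(* If [x] already occurs in [s], nothing changes at this step. *)
have rx : red (F1 x) (F' x) by rewrite /F1; case: ifP => // _; apply: red_refl.
have rF1 : rank (F1 x) = size (att x).
  by rewrite -(rF x) /F1; case: ifP => // _; case: (FF x).
have tF1 e : e != x -> typed (F1 e) by rewrite /F1; case: ifP.
have c := ctx_plug (e := x) tF1; rewrite -rF1 in c.
apply: red_iso (red_ctx rx c); apply: gsub_congr_fill => e; rewrite /plug.
  by case: eqVneq => [->|_]; apply: hiso_refl.
by rewrite /F1 inE; case: eqVneq => [->|_]; apply: hiso_refl.
Qed.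

(** The left rule for division read as a reduction, its side premises being the sequents
    [F d -> lab d]. The left rules for products and exponentials, weakening and contraction are put
    in the same form below. *)
Lemma red_div N D (e0 : hE D) (F : hE D -> hgraph (label P)) :
  is_type (Div N D) -> is_dollar (lab e0) ->
  (forall d, d != e0 -> HMEL0 (F d) (lab d)) ->
  red (handle N) (gsub (plug e0 (handle (Div N D)) F)).
Proof.
move=> t d0 Fd; have [tN rD rN tD rt] := is_type_div t d0; split.
- exact: typed_handle.
- apply: typed_plug; first exact: typed_handle.
  by move=> d /Fd/HMEL0_typed[].
- by rewrite rank_gsub rank_handle.
move=> s C B; rewrite rank_handle => -[G [e [tG sz _ CG]]] CN.
have i : repl D (fun d => Some (if d == e0 then handle (Div N D) else F d)) ~=
    gsub (plug e0 (handle (Div N D)) F) by apply: repl_all_gsub.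
have rW : rank (gsub (plug e0 (handle (Div N D)) F)) = rk N by rewrite rank_gsub.
apply: HMEL0_hiso (hiso_sym (CG _ rW)) _.
apply: HMEL0_hiso (repl1_congr _ tG i) _; apply: HMEL0_divL => //.
by apply: HMEL0_hiso CN; apply: CG; rewrite rank_handle.
Qed.

Lemma red_times M : is_type (Times M) -> red M (handle (Times M)).
Proof.
move=> t; have tM := is_type_times t; split=> //; first exact: typed_handle.
  by rewrite rank_handle.
move=> s C B [G [e [tG sz _ CG]]] CM.
apply: HMEL0_hiso (hiso_sym (CG _ _)) _; first by rewrite rank_handle.
by apply: HMEL0_timesL => //; apply: HMEL0_hiso CM; apply: CG.
Qed.

Lemma red_hplus0 U W :
  typed U -> typed W -> rank U = 0 -> rank W = 0 ->
  (forall H B, HMEL0 (hplus H U) B -> HMEL0 (hplus H W) B) -> red U W.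
Proof.
move=> tU tW rU rW UW; split; rewrite ?rU //.
move=> s C B /ctx0_hplus[H [_ _ CH]] CU.
apply: HMEL0_hiso (hiso_sym (CH _ rW)) _; apply: UW.
exact: HMEL0_hiso (CH _ rU) CU.
Qed.

Lemma red_bangL A : is_type (Bang A) -> red (handle A) (handle (Bang A)).
Proof.
move=> t; have [tA rA] := is_type_bang t.
apply: red_hplus0; rewrite ?rank_handle //; try exact: typed_handle.
by move=> H B; apply: HMEL0_bangL.
Qed.

Lemma red_weak A : is_type (Bang A) -> red (hempty _) (handle (Bang A)).
Proof.
move=> t; apply: red_hplus0; rewrite ?rank_handle //.
- exact: typed_hempty.
- exact: typed_handle.
move=> H B HB; apply: HMEL0_weak => //.
exact: HMEL0_hiso (hplus0 _) HB.
Qed.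

Lemma red_contr A : is_type (Bang A) ->
  red (hplus (handle (Bang A)) (handle (Bang A))) (handle (Bang A)).
Proof.
move=> t; apply: red_hplus0; rewrite ?rank_hplus ?rank_handle //.
- by apply/typed_hplus; split; apply: typed_handle.
- exact: typed_handle.
move=> H B HB; apply: HMEL0_contr => //.
apply: HMEL0_hiso HB; apply: hplus_congr; first exact: hiso_refl.
apply: hplus_congr; first exact: hiso_refl.
exact: hiso_sym (hplus0 _).
Qed.

Lemma red_hplus U U' W W' : rank U = 0 -> rank U' = 0 ->
  red U W -> red U' W' -> red (hplus U U') (hplus W W').
Proof.
move=> rU rU' UW UW'; have [tU tW r _] := UW; have [tU' tW' r' _] := UW'.
have c' := ctx_hplus tU; rewrite -rU' in c'.
apply: red_trans (red_ctx UW' c') _.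
have c := ctx_hplus tW'; rewrite -rU in c.
apply: red_iso (red_ctx UW c); apply: hplusC; first by rewrite -r'.
by rewrite -r'.
Qed.

Lemma red_weak_sum As : typed (hsum_bang prk As) ->
  red (hempty _) (hsum_bang prk As).
Proof.
elim: As => [|A As IH] /=; first by move=> _; apply: red_refl; apply: typed_hempty.
move=> /typed_hplus[tA /IH rAs]; have t : is_type (Bang A) by case: tA => _ /(_ tt).
apply: red_iso (red_hplus _ _ (red_weak t) rAs) => //; first exact: hplus0.
exact: hiso_refl.
Qed.

(* Exchanging the middle summands lets contraction act on each !A_i separately. *)
Lemma hplusACA G H X Y : rank H = 0 ->
  hplus (hplus G H) (hplus X Y) ~= hplus (hplus G X) (hplus H Y).
Proof.
move=> rH; apply: hiso_trans (hiso_sym (hplusA _ _ _)) _.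
apply: hiso_trans (hplusA _ _ _); apply: hplus_congr; first exact: hiso_refl.
apply: hiso_trans (hplusA _ _ _) _; apply: hiso_trans (hiso_sym (hplusA _ _ _)).
by apply: hplus_congr; [exact: hplusC|exact: hiso_refl].
Qed.

Lemma red_contr_sum As : typed (hsum_bang prk As) ->
  red (hplus (hsum_bang prk As) (hsum_bang prk As)) (hsum_bang prk As).
Proof.
elim: As => [|A As IH] /=.
  move=> _; apply: red_iso (red_refl (typed_hempty)); last exact: hiso_refl.
  exact: hiso_sym (hplus0 _).
move=> /typed_hplus[tA /IH rAs]; have t : is_type (Bang A) by case: tA => _ /(_ tt).
apply: red_iso (red_hplus _ _ (red_contr t) rAs);
  rewrite ?rank_hplus ?rank_hsum ?rank_handle //.
  by apply: hplusACA; rewrite rank_handle.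
exact: hiso_refl.
Qed.

(** * Cuts on subtypes and principal cuts *)

Definition cut l := forall K, HMEL0 K l -> red (handle l) K.

(** The hypothesis of the structural induction on types. For a division it also mentions the dollar
    label, where [cut] holds vacuously because no derivable sequent has a dollar on the right. *)
Definition cut_below l : Prop :=
  match l with
  | Div N D => cut N /\ forall e : hE D, cut (lab e)
  | Times M => forall e : hE M, cut (lab e)
  | Bang A => cut A
  | _ => True
  end.

(* The premises of the right rule with conclusion [X -> l] *)
Definition rintro l X : Prop :=
  match l with
  | Div N D => exists2 e0 : hE D, is_dollar (lab e0) & HMEL0 (repl1 D e0 X) N
  | Times M => exists2 F : hE M -> hgraph (label P),
      forall m, HMEL0 (F m) (lab m) & X ~= gsub F
  | Bang A => exists2 As, X ~= hsum_bang prk As & HMEL0 X A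
  | _ => False
  end.

Lemma cut_same l l' : same l l' -> cut l -> cut l'.
Proof.
move=> s c K Kl; have Kl' : HMEL0 K l := HMEL0_iso (hiso_refl K) (same_sym s) Kl.
have [_ tl _] := HMEL0_typed Kl'.
exact: red_iso (handle_iso s tl) (hiso_refl K) (c K Kl').
Qed.

Lemma cut_below_same l l' : same l l' -> cut_below l -> cut_below l'.
Proof.
case=> //=.
- move=> N N' D D' sN /hiso_sym[f g _ _ _ hl _] [cN cD].
  split=> [|e]; first exact: cut_same sN cN.
  exact: cut_same (same_sym (hl e)) (cD _).
- move=> M M' /hiso_sym[f g _ _ _ hl _] cM e.
  exact: cut_same (same_sym (hl e)) (cM _).
- by move=> A A'; apply: cut_same.
Qed.

Lemma rintro_same l l' X X' : is_type l -> same l l' -> X ~= X' ->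
  rintro l X -> rintro l' X'.
Proof.
move=> t s; have [t' _] := same_type s t; case: s t t' => //=.
- move=> N N' D D' sN [f g bf bg ha hl he] t t' XX [e0 d0 DN].
  have d0' : is_dollar (lab (g e0)) by rewrite -(same_dollarE (hl e0)).
  have [_ rD _ tD _] := is_type_div t d0; have [_ rD' _ tD' _] := is_type_div t' d0'.
  exists (g e0) => //; apply: HMEL0_iso sN DN.
  (* [D] contains a dollar and so is not [typed]; [repl1_gsub], which asks only for ranks away from
     the hole, still applies. *)
  apply: hiso_trans (repl1_gsub (prk := prk) _ _) _; first by move=> *; apply: rD.
  apply: hiso_trans (hiso_sym (repl1_gsub (prk := prk) _ _)); last first.
    by move=> *; apply: rD'.
  apply: hiso_trans (gsub_congr_host _ bf bg ha he).
  apply: gsub_congr_fill => e; rewrite /plug (inj_eq (bij_inj bg)).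
  by case: eqVneq => // /tD te; apply: handle_iso.
- move=> M M' /hiso_sym[f g bf bg ha hl he] _ _ XX [F Fm XF].
  exists (fun m => F (g m)).
    by move=> m; apply: HMEL0_iso (hiso_refl _) (same_sym (hl m)) (Fm _).
  apply: hiso_trans (hiso_sym XX) (hiso_trans XF _).
  exact: hiso_sym (gsub_congr_host _ bf bg ha he).
- move=> A A' sA _ _ XX [As XAs XA]; exists As.
    exact: hiso_trans (hiso_sym XX) XAs.
  exact: HMEL0_iso XX sA XA.
Qed.

(** Principal cut for division. A cut on [N] reduces its handle to [D] with [Y] at the dollar; cuts
    on the remaining labels of [D] then bring in the hypergraphs [F d]. *)
Lemma rintro_div N D (e0 : hE D) Y (F : hE D -> hgraph (label P)) :
  is_type (Div N D) -> is_dollar (lab e0) -> typed Y -> rank Y = rk (Div N D) ->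
  rintro (Div N D) Y -> cut_below (Div N D) ->
  (forall d, d != e0 -> HMEL0 (F d) (lab d)) ->
  red (handle N) (gsub (plug e0 Y F)).
Proof.
move=> t d0 tY rY [e1 d1 YN] [cN cD] Fd.
have [_ rD _ tD rt] := is_type_div t d0.
have e10 : e1 = e0.
  case: (eqVneq e1 e0) => // /tD; case: (lab e1) d1 => // d _ td.
  by inversion td.
subst e1; apply: red_trans (cN _ YN) _.
pose h (d : hE D) := handle (lab d).
apply: (@red_iso (gsub (plug e0 Y h)) _ (gsub (plug e0 Y F))).
- by apply/hiso_sym/repl1_gsub => e _; apply: rD.
- exact: hiso_refl.
apply: red_gsub => d; rewrite /plug; case: eqVneq => [dE|ne].
- exact: red_refl.
- exact: cD (Fd _ ne).
- by rewrite rY rt dE.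
- by rewrite rank_handle rD.
Qed.

(** Principal cut for products: one cut for each label of [M]. *)
Lemma rintro_times M Y : is_type (Times M) ->
  rintro (Times M) Y -> cut_below (Times M) -> red M Y.
Proof.
move=> t [F Fm YF] cM; have [rM _] := is_type_times t.
apply: red_iso (gsub_handles rM) (hiso_sym YF) _.
apply: red_gsub => m; first exact: cM (Fm m).
by rewrite rank_handle rM.
Qed.

(** The principal cuts against the left rule for [Bang], weakening and contraction. The last two
    rest on [Y] being a sum of handles of banged types. *)
Lemma rintro_bang A Y : is_type (Bang A) -> typed Y ->
  rintro (Bang A) Y -> cut_below (Bang A) ->
  [/\ red (handle A) Y, red (hempty _) Y & red (hplus Y Y) Y].
Proof.
move=> t tY [As YAs YA] cA; have tAs := typed_iso YAs tY.
have AsY := hiso_sym YAs.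
split; first exact: cA.
  exact: red_iso (hiso_refl _) AsY (red_weak_sum tAs).
exact: red_iso (hplus_congr AsY AsY) AsY (red_contr_sum tAs).
Qed.

(** * Simultaneous replacement of handles of the cut type *)

Section Replace.
Variables (A : label P) (K : hgraph (label P)).
Hypotheses (KA : HMEL0 K A) (rKA : rintro A K) (sA : cut_below A).

(** The admissible fillers of a hyperedge labelled [l]. Replacement stays optional, and [l] is
    compared with [A] by [same] because derivations may exchange identified types. *)
Definition cutgood l X := X ~= handle l \/ same l A /\ X ~= K.

(* [X] arises from [H] by replacing some handles of [A] by [K]. *)
Definition cutrel H X := exists2 F : hE H -> hgraph (label P),
  forall e, cutgood (lab e) (F e) & X ~= gsub F.

Lemma cutgood_same l l' X : is_type l -> same l l' -> cutgood l X -> cutgood l' X.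
Proof.
move=> t s [XX|[sl XX]].
  by left; apply: hiso_trans XX _; apply: handle_iso.
by right; split=> //; apply: same_trans (same_sym s) sl.
Qed.

Lemma cutgood_iso l X X' : X ~= X' -> cutgood l X -> cutgood l X'.
Proof.
by move=> /hiso_sym XX [i|[s i]]; [left|right; split=> //]; apply: hiso_trans XX i.
Qed.

Lemma cutgood_typed l X : is_type l -> cutgood l X -> typed X /\ rank X = rk l.
Proof.
move=> tl [i|[s i]]; rewrite (hiso_rank i).
  by rewrite rank_handle; split=> //; apply: typed_iso (hiso_sym i) (typed_handle tl).
have [tK tA rK] := HMEL0_typed KA; have [_ r] := same_type s tl.
by rewrite rK r; split=> //; apply: typed_iso (hiso_sym i) tK.
Qed.

(** A replaced handle carries, transported from [A] to [l], both the premises of its right rule and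
    the cuts on subtypes, which are the inputs of the principal cuts. *)
Lemma cutgood_cases l X : is_type l -> cutgood l X ->
  X ~= handle l \/ [/\ rintro l X, cut_below l, typed X & rank X = rk l].
Proof.
move=> tl g; have [tX rX] := cutgood_typed tl g; case: g => [|[s i]]; first by left.
right; split=> //; last exact: cut_below_same (same_sym s) sA.
have [_ tA _] := HMEL0_typed KA.
exact: rintro_same tA (same_sym s) (hiso_sym i) rKA.
Qed.

Lemma cutrel_isor H X X' : X ~= X' -> cutrel H X -> cutrel H X'.
Proof.
by move=> XX [F Fg XF]; exists F => //; apply: hiso_trans (hiso_sym XX) XF.
Qed.

Lemma cutrel_isol H H' X : typed H -> H ~= H' -> cutrel H X -> cutrel H' X.
Proof.
move=> [_ tH] /hiso_sym[f g bf bg ha hl he] [F Fg XF].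
exists (fun e => F (g e)).
  by move=> e; apply: cutgood_same (tH _) (same_sym (hl e)) (Fg _).
exact: hiso_trans XF (hiso_sym (gsub_congr_host _ bf bg ha he)).
Qed.

(** By associativity, replacing handles in a composite amounts to replacing them in each of its
    parts. *)
Lemma cutrel_gsub_inv G (F : hE G -> hgraph (label P)) X : cutrel (gsub F) X ->
  exists2 F' : hE G -> hgraph (label P),
    forall e, cutrel (F e) (F' e) & X ~= gsub F'.
Proof.
move=> [S Sg XS]; pose S2 e (y : hE (F e)) := S (existT _ e y).
exists (fun e => gsub (S2 e)).
  by move=> e; exists (S2 e) => [y|]; [apply: (Sg (existT _ e y))|apply: hiso_refl].
apply: hiso_trans XS _; apply: hiso_trans (gsub_assoc S2).
by apply: gsub_congr_fill => -[e y]; apply: hiso_refl.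
Qed.

Lemma cutrel_gsub G (F F' : hE G -> hgraph (label P)) :
  (forall e, cutrel (F e) (F' e)) -> cutrel (gsub F) (gsub F').
Proof.
move=> FF.
have /fin_all_exists[S SP] e : exists S : hE (F e) -> hgraph (label P),
    (forall y, cutgood (lab y) (S y)) /\ F' e ~= gsub S.
  by have [S ? ?] := FF e; exists S.
exists (fun x => let: existT e y := x in S e y).
  by move=> [e y]; apply: (proj1 (SP e)).
apply: hiso_trans (hiso_sym (gsub_assoc S)).
by apply: gsub_congr_fill => e; apply: (proj2 (SP e)).
Qed.

Lemma cutrel_handle l X : is_type l -> cutgood l X -> cutrel (handle l) X.
Proof.
move=> tl g; exists (fun _ => X) => //.
have [_ rX] := cutgood_typed tl g.
by apply: hiso_sym; apply: gsub_handle rX (hiso_refl _).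
Qed.

Lemma cutrel_handle_inv l X : is_type l -> cutrel (handle l) X -> cutgood l X.
Proof.
move=> tl [F Fg XF]; apply: cutgood_iso (Fg tt); apply/hiso_sym/(hiso_trans XF).
by apply: gsub_handle (hiso_refl _); case: (cutgood_typed tl (Fg tt)).
Qed.

Lemma cutrel_refl H : typed H -> cutrel H H.
Proof.
case=> rH tH; exists (fun e => handle (lab e)) => [e|]; first by left; apply: hiso_refl.
exact: hiso_sym (gsub_handles rH).
Qed.

Lemma cutrel_typed H X : typed H -> cutrel H X -> typed X /\ rank X = rank H.
Proof.
move=> [rH tH] [F Fg XF]; split; last by rewrite (hiso_rank XF) rank_gsub.
apply: typed_iso (hiso_sym XF) _; apply/typed_gsub => e.
by case: (cutgood_typed (tH e) (Fg e)).
Qed.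

Lemma cutrel_hplus G G' H H' :
  cutrel G G' -> cutrel H H' -> cutrel (hplus G H) (hplus G' H').
Proof.
move=> [F Fg i] [F' Fg' i'].
exists (fun e : hE (hplus G H) => match e with inl e => F e | inr e => F' e end).
  by case=> e; [apply: Fg|apply: Fg'].
by apply: hiso_trans (hplus_congr i i') _; apply/hiso_sym/gsub_hplus.
Qed.

Lemma cutrel_hplus_inv G H X : cutrel (hplus G H) X ->
  exists G' H', [/\ cutrel G G', cutrel H H' & X ~= hplus G' H'].
Proof.
move=> [F Fg XF].
exists (gsub (fun e => F (inl e))), (gsub (fun e => F (inr e))); split.
- by exists (fun e => F (inl e)) => [e|]; [apply: (Fg (inl e))|apply: hiso_refl].
- by exists (fun e => F (inr e)) => [e|]; [apply: (Fg (inr e))|apply: hiso_refl].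
- exact: hiso_trans XF (gsub_hplus _).
Qed.

(** Typing away from the hole, to cover the hypergraph of a division, whose hole carries a
    dollar. *)
Definition typed_off G (e : hE G) := forall e', e' != e ->
  size (att e') = rk (lab e') /\ is_type (lab e').

Lemma typed_typed_off G (e : hE G) : typed G -> typed_off e.
Proof. by case=> rG tG e' _. Qed.

Lemma cutrel_repl1 G (e : hE G) Z Z' (F : hE G -> hgraph (label P)) :
  typed_off e -> typed Z -> cutrel Z Z' ->
  (forall e', e' != e -> cutgood (lab e') (F e')) ->
  cutrel (repl1 G e Z) (gsub (plug e Z' F)).
Proof.
move=> tG tZ ZZ Fg; pose h (e' : hE G) := handle (lab e').
apply: (@cutrel_isol (gsub (plug e Z h))).
- by apply: typed_plug => // e' /tG[_]; apply: typed_handle.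
- by apply/hiso_sym/repl1_gsub => e' /tG[].
apply: cutrel_gsub => e'; rewrite /plug; case: eqVneq => // ne.
by apply: cutrel_handle; [case: (tG _ ne)|apply: Fg].
Qed.

Lemma cutrel_repl1_same G (e : hE G) Z Z' :
  typed_off e -> typed Z -> cutrel Z Z' -> cutrel (repl1 G e Z) (repl1 G e Z').
Proof.
move=> tG tZ ZZ; pose h (e' : hE G) := handle (lab e').
apply: (@cutrel_isor _ (gsub (plug e Z' h))).
  by apply/hiso_sym/repl1_gsub => e' /tG[].
by apply: cutrel_repl1 => // e' _; left; apply: hiso_refl.
Qed.

Lemma cutrel_repl1_inv G (e : hE G) Z X :
  typed G -> typed Z -> cutrel (repl1 G e Z) X ->
  exists Z' (F : hE G -> hgraph (label P)), [/\ cutrel Z Z',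
     forall e', e' != e -> cutgood (lab e') (F e') & X ~= gsub (plug e Z' F)].
Proof.
move=> tG tZ /(cutrel_isol (typed_repl1 e tG tZ) (repl1_plug _ _ tG)).
move=> /cutrel_gsub_inv[F FF XF]; exists (F e), F; split.
- by have := FF e; rewrite /plug eqxx.
- move=> e' ne; have := FF e'; rewrite /plug (negPf ne).
  by apply: cutrel_handle_inv; case: tG.
- apply: hiso_trans XF _; apply: gsub_congr_fill => e'; rewrite /plug.
  by case: eqVneq => [->|_]; apply: hiso_refl.
Qed.

(** The common pattern of the left rules: [U] in the premise becomes [W] in the conclusion. Once
    handles are replaced, [W] has turned into some [Y]; the induction hypothesis is used with a
    matching [U'], and the reduction from [U'] to [Y] is applied in the replaced context. *)
Lemma left_repl1 G (e : hE G) U W B X :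
  typed G -> typed U -> typed W -> size (att e) = rank U ->
  (forall Y, cutrel W Y -> exists2 U', cutrel U U' & red U' Y) ->
  (forall Y, cutrel (repl1 G e U) Y -> HMEL0 Y B) ->
  cutrel (repl1 G e W) X -> HMEL0 X B.
Proof.
move=> tG tU tW sz UW IH /(cutrel_repl1_inv tG tW)[Y [F [WY Fg XF]]].
have [U' UU' U'Y] := UW _ WY.
apply: HMEL0_hiso (hiso_sym XF) _.
have := IH _ (cutrel_repl1 (typed_typed_off tG) tU UU' Fg); apply: red_HMEL0.
have tF e' : e' != e -> typed (F e').
  by move=> /Fg g; case: (cutgood_typed _ g) => //; case: tG.
have c := ctx_plug (e := e) tF; have [_ rU'] := cutrel_typed tU UU'.
by rewrite sz -rU' in c; apply: red_ctx U'Y c.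
Qed.

Lemma left_hplus H U W B X :
  typed H -> typed U -> rank U = 0 ->
  (forall Y, cutrel W Y -> exists2 U', cutrel U U' & red U' Y) ->
  (forall Y, cutrel (hplus H U) Y -> HMEL0 Y B) ->
  cutrel (hplus H W) X -> HMEL0 X B.
Proof.
move=> tH tU rU UW IH /cutrel_hplus_inv[H' [Y [HH WY XY]]].
have [U' UU' U'Y] := UW _ WY; have [tH' _] := cutrel_typed tH HH.
apply: HMEL0_hiso (hiso_sym XY) _.
have := IH _ (cutrel_hplus HH UU'); apply: red_HMEL0.
have c := ctx_hplus tH'; have [_ rU'] := cutrel_typed tU UU'.
by rewrite -rU -rU' in c; apply: red_ctx U'Y c.
Qed.

Lemma hsum_bang_cat As As' :
  hplus (hsum_bang prk As) (hsum_bang prk As') ~= hsum_bang prk (As ++ As').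
Proof.
elim: As => [|C As IH] /=.
  exact: hiso_trans (hplusC (G := hempty _) _ (erefl _)) (hplus0 _).
apply: hiso_trans (hiso_sym (hplusA _ _ _)) _.
by apply: hplus_congr; first exact: hiso_refl.
Qed.

(** Needed to reapply the right rule for [Bang]: a handle of [Bang C] is either kept or replaced by
    a filler which its own right rule shows to be a sum of banged handles. *)
Lemma cutrel_hsum As X : typed (hsum_bang prk As) -> cutrel (hsum_bang prk As) X ->
  exists As', X ~= hsum_bang prk As'.
Proof.
elim: As X => [|C As IH] X /=.
  by move=> _ [F _ XF]; exists [::]; apply: hiso_trans XF (gsub_hempty prk _).
move=> /typed_hplus[tC tAs] /cutrel_hplus_inv[Y [Z [CY /(IH _ tAs)[As' ZAs'] XYZ]]].
have t : is_type (Bang C) by case: tC => _ /(_ tt).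
have [As0 YAs0] : exists As0, Y ~= hsum_bang prk As0.
  have [YC|[[As0 YAs0 _] _ _ _]] := cutgood_cases t (cutrel_handle_inv t CY);
    last by exists As0.
  by exists [:: C]; apply: hiso_trans YC (hiso_sym (hplus0 _)).
exists (As0 ++ As'); apply: hiso_trans XYZ _.
exact: hiso_trans (hplus_congr YAs0 ZAs') (hsum_bang_cat _ _).
Qed.

(** Right rules are reapplied to the replaced premises. At a left rule, a principal handle that was
    kept calls for the same rule again, and one that was replaced calls for a principal cut. *)
Lemma HMEL0_cutrel H B : HMEL0 H B -> forall X, cutrel H X -> HMEL0 X B.
Proof.
elim=> {H B}.
- move=> H H' C C' HH CC HC IH X HX; have [tH _ _] := HMEL0_typed HC.
  apply: HMEL0_iso (hiso_refl X) CC (IH _ _).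
  by apply: cutrel_isol (typed_iso HH tH) (hiso_sym HH) HX.
- move=> C tC X /(cutrel_handle_inv tC)[XC|[s XK]].
    exact: HMEL0_hiso (hiso_sym XC) (HMEL0_ax tC).
  (* The handle of the axiom was itself replaced, so the given derivation of [K -> A] is what is
     sought. *)
  exact: HMEL0_iso (hiso_sym XK) (same_sym s) KA.
- move=> H e N D e0 Hs C t d0 tH sz HC IHC HD IHD X.
  have [tN rD rN tD rt] := is_type_div t d0.
  have tHs d : typed (if d == e0 then handle (Div N D) else Hs d).
    case: eqVneq => [_|ne]; first exact: typed_handle.
    by have [] := HMEL0_typed (HD _ ne).
  have i := repl_all_gsub prk (fun d => if d == e0 then handle (Div N D) else Hs d).
  have tW := typed_iso (hiso_sym i) (proj2 (typed_gsub _) tHs).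
  apply: left_repl1 IHC => //; first exact: typed_handle.
    by rewrite rank_handle.
  move=> Y /(cutrel_isol tW i)/cutrel_gsub_inv[F FF YF].
  (* The handle of [N] occurs only in the premise and is kept there, even if [N] is identified with
     [A]. *)
  exists (handle N); first by apply/cutrel_refl/typed_handle.
  have Fd d : d != e0 -> HMEL0 (F d) (lab d).
    by move=> ne; apply: (IHD _ ne); have := FF d; rewrite (negPf ne).
  have YF0 : gsub (plug e0 (F e0) F) ~= Y.
    apply: hiso_sym; apply: hiso_trans YF _; apply: gsub_congr_fill => d; rewrite /plug.
    by case: eqVneq => [->|_]; apply: hiso_refl.
  apply: red_iso (hiso_refl _) YF0 _.
  have : cutrel (handle (Div N D)) (F e0) by have := FF e0; rewrite eqxx.
  move=> /(cutrel_handle_inv t)/(cutgood_cases t)[Fe|[r c tF rF]].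
    apply: red_iso (hiso_refl _) _ (red_div t d0 Fd).
    by apply: plug_congr => [|d _]; [apply: hiso_sym|apply: hiso_refl].
  exact: rintro_div.
- move=> F N D e0 t d0 tF rF HN IH X FX; have [tX rX] := cutrel_typed tF FX.
  apply: (HMEL0_divR t d0 tX); first by rewrite rX.
  apply: IH; apply: cutrel_repl1_same => // d ne.
  by have [_ rD _ tD _] := is_type_div t d0; split; [apply: rD|apply: tD].
- move=> M Hs t HM IH X; have i := repl_all_gsub prk Hs.
  have tH : typed (repl M (fun m => Some (Hs m))).
    apply: typed_iso (hiso_sym i) _; apply/typed_gsub => m.
    by have [] := HMEL0_typed (HM m).
  move=> /(cutrel_isol tH i)/cutrel_gsub_inv[F FF XF].
  apply: HMEL0_hiso (hiso_sym (hiso_trans XF (hiso_sym (repl_all_gsub prk _)))) _.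
  by apply: HMEL0_timesR => // m; apply: IH.
- move=> H e M C t tH sz HC IH X; have tM := is_type_times t.
  apply: left_repl1 IH => //; first exact: typed_handle.
  move=> Y /(cutrel_handle_inv t)/(cutgood_cases t)[YM|[r c _ _]]; exists M.
  + exact: cutrel_refl.
  + exact: red_iso (hiso_refl _) (hiso_sym YM) (red_times t).
  + exact: cutrel_refl.
  + exact: rintro_times.
- move=> H C B t HB IH X; have [/typed_hplus[tH tC] _ _] := HMEL0_typed HB.
  have [_ rC] := is_type_bang t.
  apply: left_hplus IH => //; first by rewrite rank_handle.
  move=> Y /(cutrel_handle_inv t)/(cutgood_cases t)[YM|[r c tY _]]; exists (handle C).
  + exact: cutrel_refl.
  + exact: red_iso (hiso_refl _) (hiso_sym YM) (red_bangL t).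
  + exact: cutrel_refl.
  + by have [] := rintro_bang t tY r c.
- move=> As C t HC IH X AsX; have [tAs _ _] := HMEL0_typed HC.
  have [As' XAs'] := cutrel_hsum tAs AsX.
  apply: HMEL0_hiso (hiso_sym XAs') (HMEL0_bangR t _).
  exact: HMEL0_hiso XAs' (IH _ AsX).
- move=> H C B t HB IH X; have [tH _ _] := HMEL0_typed HB.
  have tE := typed_hempty.
  apply: left_hplus (tH) (tE) (erefl _) _ _ => [Y|Y HY].
    move=> /(cutrel_handle_inv t)/(cutgood_cases t)[YM|[r c tY _]]; exists (hempty _).
    + exact: cutrel_refl.
    + exact: red_iso (hiso_refl _) (hiso_sym YM) (red_weak t).
    + exact: cutrel_refl.
    + by have [] := rintro_bang t tY r c.
  apply: IH; apply: cutrel_isol (hplus0 _) HY.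
  by apply/typed_hplus.
- move=> H C B t HB IH X; have [/typed_hplus[tH tCC] _ _] := HMEL0_typed HB.
  have i : hplus (handle (Bang C)) (handle (Bang C)) ~= hmul 2 (handle (Bang C)).
    by apply: hplus_congr; [apply: hiso_refl|apply/hiso_sym/hplus0].
  have tU := typed_iso (hiso_sym i) tCC.
  apply: left_hplus (tH) (tU) _ _ _; first by rewrite rank_hplus rank_handle.
    (* Both copies in the premise receive the filler chosen for the single handle in the
       conclusion. *)
    move=> Y CY; exists (hplus Y Y); first exact: cutrel_hplus.
    have [YM|[r c tY _]] := cutgood_cases t (cutrel_handle_inv t CY).
    + have MY := hiso_sym YM.
      exact: red_iso (hplus_congr MY MY) MY (red_contr t).
    + by have [] := rintro_bang t tY r c.
  move=> Y HY; apply: IH; apply: cutrel_isol HY; first by apply/typed_hplus.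
  by apply: hplus_congr; first exact: hiso_refl.
Qed.

(** The instance of simultaneous replacement in which only the handle in the hole is replaced. *)
Lemma red_rintro : red (handle A) K.
Proof.
have [tK tA rK] := HMEL0_typed KA; have tH := typed_handle tA.
split=> //; first by rewrite rank_handle.
rewrite rank_handle => s C B [G [e [tG sz _ CG]]] CB.
apply: HMEL0_hiso (hiso_sym (CG _ rK)) _.
have: HMEL0 (repl1 G e (handle A)) B.
  by apply: HMEL0_hiso CB; apply: CG; rewrite rank_handle.
move=> /HMEL0_cutrel; apply; apply: cutrel_repl1_same => //.
  exact: typed_typed_off.
by apply: cutrel_handle => //; right; split; [apply: same_refl|apply: hiso_refl].
Qed.

End Replace.

(** Left and structural rules transform only the antecedent, by a reduction that composes with the
    induction hypothesis for the same [A]. Right rules supply [rintro], hence fall under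
    [red_rintro]. *)
Lemma cut_below_red K A : HMEL0 K A -> cut_below A -> red (handle A) K.
Proof.
elim=> {K A}.
- move=> H H' A A' HH AA HA IH /(cut_below_same (same_sym AA))/IH r.
  have [_ tA _] := HMEL0_typed HA.
  exact: red_iso (handle_iso AA tA) HH r.
- by move=> A tA _; apply/red_refl/typed_handle.
- move=> H e N D e0 Hs A t d0 tH sz HA IH HD _ /IH r.
  apply: red_trans r _; have i := repl_all_gsub prk
    (fun d => if d == e0 then handle (Div N D) else Hs d).
  have rN := red_iso (hiso_refl _) (hiso_sym i) (red_div t d0 HD).
  by apply: red_ctx rN _; rewrite rank_handle -sz; apply: ctx_repl1.
- move=> F N D e0 t d0 tF rF HN _ c.
  by apply: red_rintro => //; [apply: HMEL0_divR HN|exists e0].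
- move=> M Hs t HM _ c.
  apply: red_rintro => //; first exact: HMEL0_timesR.
  by exists Hs => //; apply: repl_all_gsub.
- move=> H e M A t tH sz HA IH /IH r; apply: red_trans r _.
  by apply: red_ctx (red_times t) _; rewrite -sz; apply: ctx_repl1.
- move=> H A B t HB IH /IH r; apply: red_trans r _.
  have [/typed_hplus[tH _] _ _] := HMEL0_typed HB; have [_ rA] := is_type_bang t.
  by apply: red_ctx (red_bangL t) _; rewrite rank_handle rA; apply: ctx_hplus.
- move=> As A t HA _ c.
  apply: red_rintro => //; first exact: HMEL0_bangR.
  by exists As => //; apply: hiso_refl.
- move=> H A B t HB IH /IH r; apply: red_trans r _.
  have [tH _ _] := HMEL0_typed HB.
  apply: red_iso (hplus0 _) (hiso_refl _) (red_ctx (red_weak t) _).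
  exact: ctx_hplus.
- move=> H A B t HB IH /IH r; apply: red_trans r _.
  have [/typed_hplus[tH _] _ _] := HMEL0_typed HB.
  apply: red_iso _ (hiso_refl _) (red_ctx (red_contr t) _); last first.
    by rewrite rank_hplus rank_handle; apply: ctx_hplus.
  apply: hplus_congr; first exact: hiso_refl.
  by apply: hplus_congr; [apply: hiso_refl|apply/hiso_sym/hplus0].
Qed.

Lemma cut_admissible A : cut A.
Proof.
(* The nested induction hypotheses are exactly [cut_below], which is trivial at dollars and
   primitive types. *)
by elim/label_nested_ind: A => [d|p|N D cN cD|M cM|A cA] K /cut_below_red; apply.
Qed.

End CutElimination.

Theorem theorem1 (P : Type) (prk : P -> nat) (H G : hgraph (label P))
  (e0 : hE G) (A B : label P) :
  HMEL0 prk H A ->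
  typed prk G -> size (att e0) = rk prk A ->
  HMEL0 prk (repl1 G e0 (handle prk A)) B ->
  HMEL0 prk (repl1 G e0 H) B.
Proof.
move=> HA tG sz; have [_ _ _ r] := cut_admissible HA.
apply: r; rewrite rank_handle -sz; exact: ctx_repl1.
Qed.
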